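(* Let $n\geq 1$, let $\preceq\in\operatorname{Ord}_n$, and let $\mathbb{K}$ be an algebraically closed field of characteristic $p>0$. Then the set $\mathcal{S}^{\mathbb{K}}_{\preceq}$ of all series $\xi$ with coefficients in $\mathbb{K}$ for which there exist $k\in\mathbb{N}^*$, $\gamma\in\mathbb{Z}^n$ and a $\preceq$-positive rational cone $\sigma$ containing $\mathbb{R}_{\geq 0}^n$ such that $$\operatorname{Supp}(\xi)\subset(\gamma+\sigma)\cap\tfrac1k G(p)\quad\text{and}\quad\operatorname{Supp}(\xi)\text{ is }\preceq\text{-well-ordered},$$ where $G(p)=\bigcup_{\ell\in\mathbb{N}}\frac{1}{p^\ell}\mathbb{Z}^n$, is an algebraically closed field containing $\mathbb{K}(\!(x)\!)$, $x=(x_1,\dots,x_n)$.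
   Context: $\mathbb{K}(\!(x)\!)$ is the fraction field of the formal power series ring $\mathbb{K}[[x]]$. A series is a formal sum $\xi=\sum_{\alpha\in\mathbb{Q}^n}\xi_\alpha x^\alpha$ with $\xi_\alpha\in\mathbb{K}$; $\operatorname{Supp}(\xi)=\{\alpha\mid\xi_\alpha\neq 0\}$; addition and multiplication are the usual ones for series with well-ordered support. A rational cone is a set $\{\lambda_1u_1+\cdots+\lambda_su_s\mid\lambda_i\geq 0\}$ with $u_i\in\mathbb{Z}^n$. For $u_1,\dots,u_s\in\mathbb{R}^n$, $\leq_{(u_1,\dots,u_s)}$ is the preorder on $\mathbb{R}^n$ given by $u\leq_{(u_1,\dots,u_s)}v$ iff $(u\cdot u_1,\dots,u\cdot u_s)\leq_{\mathrm{lex}}(v\cdot u_1,\dots,v\cdot u_s)$; preorders of this form are called continuous, and every total translation-invariant order on $\mathbb{Q}^n$ is the restriction of one of them. A continuous order is a continuous preorder whose restriction to $\mathbb{Q}^n$ is an order (i.e. antisymmetric). A set $A\subset\mathbb{R}^n$ is $\preceq$-positive if $a\succeq\underline{0}$ for all $a\in A$, and $\preceq$-well-ordered if it is well-ordered with respect to $\preceq$. $\operatorname{Ord}_n$ is the set of continuous orders $\preceq$ for which $\mathbb{R}_{\geq 0}^n$ is $\preceq$-positive. *)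

(* Defs.v *)
From HB Require Import structures.
From mathcomp Require Import all_boot all_order all_algebra.
From mathcomp Require Import boolp classical_sets functions wochoice cardinality.
From mathcomp Require Import fsbigop reals.
From mathcomp Require Import mpoly.

Set Implicit Arguments.
Unset Strict Implicit.
Unset Printing Implicit Defensive.

Import Order.TTheory GRing.Theory Num.Theory.
Local Open Scope classical_set_scope.
Local Open Scope ring_scope.

(* Only the pointwise additive structure of the function type is reused; the   *)
(* product is the Cauchy product.                                              *)
Definition mfps (n : nat) (K : idomainType) := 'X_{1..n} -> K.

Section PowerSeries.
Variables (n : nat) (K : idomainType).
Local Notation A := (mfps n K).
Implicit Types f g h : A.

HB.instance Definition _ := GRing.Zmodule.copy A ('X_{1..n} -> K).

Definition mfps_one : A := fun m => (m == 0%MM)%:R.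

Definition mfps_mul f g : A := fun m =>
  \sum_(k : 'X_{1..n < (mdeg m).+1, (mdeg m).+1} | m == (k.1 + k.2)%MM)
    f k.1 * g k.2.

Let trunc d f : {mpoly K[n]} := \sum_(m : 'X_{1..n < d}) f m *: 'X_[m].

Let coef_trunc d f m : (mdeg m < d)%N -> (trunc d f)@_m = f m.
Proof. exact: mcoeff_mpoly. Qed.

Let coefM_eq (p q p' q' : {mpoly K[n]}) m :
  (forall k, (mdeg k <= mdeg m)%N -> p@_k = p'@_k) ->
  (forall k, (mdeg k <= mdeg m)%N -> q@_k = q'@_k) ->
  (p * q)@_m = (p' * q')@_m.
Proof.
move=> ep eq; rewrite !mcoeffM; apply: eq_bigr => -[k1 k2] _ /=.
by rewrite ep ?eq // -ltnS bmdeg.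
Qed.

Let mfps_mulE d f g m : (mdeg m < d)%N ->
  mfps_mul f g m = (trunc d f * trunc d g)@_m.
Proof.
move=> md; rewrite mcoeffM; apply: eq_bigr => -[k1 k2] _ /=.
by rewrite !coef_trunc // (leq_trans (bmdeg _)).
Qed.

Let trunc_mul d f g k : (mdeg k < d)%N ->
  (trunc d (mfps_mul f g))@_k = (trunc d f * trunc d g)@_k.
Proof. by move=> kd; rewrite coef_trunc // (mfps_mulE _ _ kd). Qed.

Fact mfps_mulA : associative mfps_mul.
Proof.
move=> f g h; apply/funext => m.
have md : (mdeg m < (mdeg m).+1)%N by [].
rewrite !(mfps_mulE _ _ md).
rewrite (coefM_eq (p' := trunc (mdeg m).+1 f)
  (q' := trunc (mdeg m).+1 g * trunc (mdeg m).+1 h)) //; last first.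
  by move=> k kd; rewrite trunc_mul.
rewrite mulrA; apply: coefM_eq => // k kd.
by rewrite trunc_mul.
Qed.

Fact mfps_mulC : commutative mfps_mul.
Proof.
move=> f g; apply/funext => m.
by rewrite !(mfps_mulE _ _ (ltnSn (mdeg m))) mulrC.
Qed.

Fact mfps_mul1 : left_id mfps_one mfps_mul.
Proof.
move=> f; apply/funext => m; have md := ltnSn (mdeg m).
rewrite (mfps_mulE _ _ md) (coefM_eq (p' := 1) (q' := trunc (mdeg m).+1 f)) //.
  by rewrite mul1r coef_trunc.
by move=> k kd; rewrite coef_trunc // mcoeff1.
Qed.

Fact mfps_mulDl : left_distributive mfps_mul +%R.
Proof.
move=> f g h; apply/funext => m; have md := ltnSn (mdeg m).
rewrite -[RHS]/(mfps_mul f h m + mfps_mul g h m) !(mfps_mulE _ _ md).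
rewrite -mcoeffD -mulrDl.
by apply: coefM_eq => // k kd; rewrite mcoeffD !coef_trunc.
Qed.

Fact mfps_one_neq0 : mfps_one != 0.
Proof.
apply/eqP => /(congr1 (fun f : A => f 0%MM)).
by rewrite /mfps_one eqxx => /eqP; rewrite oner_eq0.
Qed.

HB.instance Definition _ := GRing.Zmodule_isComNzRing.Build A
  mfps_mulA mfps_mulC mfps_mul1 mfps_mulDl mfps_one_neq0.

Let mfps_unit : {pred A} := fun f => `[< exists g, g * f = 1 >].

Let mfps_inv f : A :=
  if pselect (exists g, g * f = 1) is left ex then projT1 (cid ex) else f.

Let mfps_mulV : {in mfps_unit, left_inverse 1 mfps_inv *%R}.
Proof.
move=> f /asboolP fu; rewrite /mfps_inv; case: pselect => // ex.
exact: (projT2 (cid ex)).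
Qed.

Let mfps_unitP f g : g * f = 1 -> mfps_unit f.
Proof. by move=> gf; apply/asboolP; exists g. Qed.

Let mfps_inv_out : {in [predC mfps_unit], mfps_inv =1 id}.
Proof. by move=> f /asboolP fu; rewrite /mfps_inv; case: pselect. Qed.

HB.instance Definition _ := GRing.ComNzRing_hasMulInverse.Build A
  mfps_mulV mfps_unitP mfps_inv_out.

Let mfps_low f : f != 0 ->
  exists m, f m != 0 /\ forall k, f k != 0 -> (m <= k)%O.
Proof.
move=> f0; have [m0 fm0] : exists m, f m != 0.
  apply: contrapT => nf; move/eqP: f0; apply; apply/funext => m.
  by apply/eqP; apply: contrapT => /negP fm; apply: nf; exists m.
elim/(@ltmwf n): m0 fm0 => m IH fm.
case: (pselect (exists2 k, (k < m)%O & f k != 0)) => [[k km fk]|nk].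
  exact: IH fk.
exists m; split=> // k fk; rewrite leNgt; apply/negP => km.
by apply: nk; exists k.
Qed.

Fact mfps_integral f g : f * g = 0 -> (f == 0) || (g == 0).
Proof.
move=> fg; apply: contrapT => /negP; rewrite negb_or => /andP[f0 g0].
have [a [fa lea]] := mfps_low f0; have [b [gb leb]] := mfps_low g0.
have : mfps_mul f g (a + b)%MM = 0 by rewrite -[LHS]/((f * g) _) fg.
have ad : (mdeg a < (mdeg (a + b)).+1)%N by rewrite mdegD ltnS leq_addr.
have bd : (mdeg b < (mdeg (a + b)).+1)%N by rewrite mdegD ltnS leq_addl.
rewrite /mfps_mul (bigD1 (BMultinom ad, BMultinom bd)) //= big1 ?addr0.
  by move/eqP; rewrite mulf_eq0 (negbTE fa) (negbTE gb).
move=> [[k1 k1d] [k2 k2d]] /= /andP[/eqP ek nk].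
apply/eqP; rewrite mulf_eq0; apply: contrapT => /negP.
rewrite negb_or => /andP[fk gk]; have le1 := lea _ fk; have le2 := leb _ gk.
move: nk; rewrite -[_ == _]/((k1 == a) && (k2 == b)).
move: le1 le2; rewrite !le_eqVlt.
case/orP => [/eqP e1|l1]; case/orP => [/eqP e2|l2].
- by rewrite e1 e2 !eqxx.
- by have := lemc_lt_add (lea _ fk) l2; rewrite -ek ltxx.
- by have := ltmc_le_add l1 (leb _ gk); rewrite -ek ltxx.
- by have := ltm_add l1 l2; rewrite -ek ltxx.
Qed.

HB.instance Definition _ := GRing.ComUnitRing_isIntegral.Build A mfps_integral.

End PowerSeries.

Section Orders.
Variables (R : realType) (n : nat).
Implicit Types (le : rel 'rV[R]_n) (A : set 'rV[R]_n).

Definition ratv (a : 'rV[rat]_n) : 'rV[R]_n := map_mx ratr a.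
Definition intv (a : 'rV[int]_n) : 'rV[R]_n := map_mx intr a.

Definition dotv (v w : 'rV[R]_n) : R := \sum_i v 0 i * w 0 i.

Definition lex_le (us : seq 'rV[R]_n) : rel 'rV[R]_n := fun v w =>
  (([seq dotv v u | u <- us] : seqlexi R) <= [seq dotv w u | u <- us])%O.

Definition continuous_preorder le := exists us, le = lex_le us.

Definition continuous_order le :=
  continuous_preorder le /\
  forall a b : 'rV[rat]_n,
    le (ratv a) (ratv b) -> le (ratv b) (ratv a) -> a = b.

Definition positive_set le A := forall a, A a -> le 0 a.

Definition orthant : set 'rV[R]_n := [set v | forall i, 0 <= v 0 i].

Definition Ord le := continuous_order le /\ positive_set le orthant.

Definition rational_cone A := exists (s : nat) (u : 'I_s -> 'rV[int]_n),
  A = [set v | exists2 l : 'I_s -> R, (forall i, 0 <= l i) &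
                 v = \sum_i l i *: intv (u i)].

Definition well_ordered_set le A := wo_chain le (mem A).

Definition Gp (p : nat) : set 'rV[R]_n :=
  \bigcup_l [set (p ^ l)%:R^-1 *: intv z | z in [set: 'rV[int]_n]].

End Orders.
Arguments orthant R n v : clear implicits.
Arguments Gp R n p v : clear implicits.

Definition qseries (n : nat) (K : idomainType) := 'rV[rat]_n -> K.

HB.instance Definition _ n K :=
  GRing.Zmodule.copy (qseries n K) ('rV[rat]_n -> K).

Section Series.
Variables (n : nat) (K : idomainType).
Implicit Types x y : qseries n K.

Definition qs_one : qseries n K := fun a => (a == 0)%:R.

(* The [fsbigop] sum ranges over the a with x a * y (c - a) != 0, and is 0 by  *)
(* convention if there are infinitely many of them, which does not happen when *)
(* the supports are well-ordered.                                              *)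
Definition qs_mul x y : qseries n K := fun c =>
  \sum_(a \in [set: 'rV[rat]_n]) x a * y (c - a).

Definition supp (R : realType) x : set 'rV[R]_n :=
  [set ratv R a | a in [set a | x a != 0]].

Definition qs_of_mfps (f : mfps n K) : qseries n K := fun a =>
  if [forall i, a 0 i \is a Num.nat]
  then f [multinom Num.truncn (a 0%R i) | i < n] else 0.

End Series.
Arguments qs_one n K a : clear implicits.
Arguments supp {n K} R x v.

Definition Sset (R : realType) (n p : nat) (le : rel 'rV[R]_n)
    (K : idomainType) : set (qseries n K) :=
  [set x | exists (k : nat) (c : 'rV[int]_n) (sigma : set 'rV[R]_n),
    [/\ (0 < k)%N,
        [/\ rational_cone sigma, positive_set le sigma & orthant R n `<=` sigma],
        supp R x `<=` [set intv R c + v | v in sigma]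
                     `&` [set k%:R^-1 *: g | g in Gp R n p] &
        well_ordered_set le (supp R x)]].
Arguments Sset {R n} p le K x.

(* Main.v *)
Require Import Defs.
From HB Require Import structures.
From mathcomp Require Import all_boot all_order all_algebra.
From mathcomp Require Import generic_quotient closed_field finmap.
From mathcomp Require Import boolp classical_sets cardinality.
From mathcomp Require Import fsbigop reals mpoly ring lra.

Set Implicit Arguments.
Unset Strict Implicit.
Unset Printing Implicit Defensive.

Import Order.TTheory GRing.Theory Num.Theory.
Local Open Scope classical_set_scope.
Local Open Scope ring_scope.

(** The supports allowed in the theorem form a family of well-ordered subsets
    of an ordered Q-vector space that contains the singletons and is closed
    under subsets, unions, sums, the monoid generated by a nonnegative member,
    division by p, and the union of all A/p^i for a negative member A.  For any
    such family (Rayner), the series with supports in it form an algebraically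
    closed field.  Indeed every polynomial over a field of characteristic p
    divides an additive one, so it is enough to split additive polynomials; if
    r is a root of an additive L, then L = M o (X^p - r^(p-1) X) with M additive
    of smaller degree, which reduces the problem to p-th roots, Artin-Schreier
    equations, and one nonzero root of each additive polynomial with nonzero
    linear coefficient.  Artin-Schreier equations are solved separately for the
    negative, constant and positive parts of the series; the nonzero root comes
    from the Newton polygon and Hensel's lemma, because the linear term makes
    the residue polynomial separable.  All these equations are solved by
    recursion along a well-ordered support.

    The closure under generated monoids rests on Neumann's lemma and on the
    fact that a well-ordered set of nonnegative exponents contained in c + sigma
    already lies in a positive rational cone.  This is proved by induction on
    the linear forms defining the order: where the first form is positive it is
    bounded below, and the part where it vanishes is cut out of c + sigma by
    rational hyperplanes. *)

(** * Well-ordered subsets of ordered groups *)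

Lemma total_seq_min (T : eqType) (r : rel T) (s : seq T) :
  transitive r -> total r -> s != [::] ->
  exists2 a, a \in s & forall b, b \in s -> r a b.
Proof.
move=> r_trans r_total; have r_refl a : r a a by have := r_total a a; rewrite orbb.
elim: s => // a s IH _; case: s IH => [|b s] IH.
  by exists a; rewrite ?mem_head // => b; rewrite inE => /eqP->.
have [c cs cmin] := IH isT; case/orP: (r_total a c) => ac; [exists a|exists c].
- exact: mem_head.
- by move=> d; rewrite inE => /orP[/eqP->//|/cmin]; apply: r_trans.
- by rewrite inE cs orbT.
- by move=> d; rewrite inE => /orP[/eqP->//|/cmin].
Qed.

Record group_order (G : zmodType) (le : rel G) : Prop := GroupOrder {
  go_anti : antisymmetric le;
  go_trans : transitive le;
  go_total : total le;
  go_add : forall c a b, le a b -> le (a + c) (b + c) }.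

Section WellOrderedSets.
Variables (G : zmodType) (le : rel G).

Definition wo (A : set G) := forall B : set G, B `<=` A -> B !=set0 ->
  exists2 b, B b & forall c, B c -> le b c.

Definition addset (A B : set G) : set G := [set a + b | a in A & b in B].

(** The submonoid generated by [A]; the empty sequence contributes 0. *)
Definition sums (A : set G) : set G :=
  [set x | exists2 s : seq G, (forall a, a \in s -> A a) & x = \sum_(a <- s) a].

Hypothesis leG : group_order le.
Local Notation "a <=@ b" := (le a b) (at level 70, no associativity).
Local Notation "a <@ b" := (~~ le b a) (at level 70, no associativity).
Implicit Types (a b c x y z : G) (A B M : set G).

Lemma gole_refl a : a <=@ a.
Proof. by have := go_total leG a a; rewrite orbb. Qed.
Hint Resolve gole_refl : core.

Lemma golt_le a b : a <@ b -> a <=@ b.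
Proof. by move=> ab; have := go_total leG a b; rewrite (negbTE ab) orbF. Qed.

Lemma gole_lt_trans b a c : a <=@ b -> b <@ c -> a <@ c.
Proof. by move=> ab; apply: contra => ca; apply: (go_trans leG ca ab). Qed.

Lemma golt_le_trans b a c : a <@ b -> b <=@ c -> a <@ c.
Proof. by move=> ab bc; apply: contra ab => /(go_trans leG bc). Qed.

Lemma gole_eqVlt a b : a <=@ b -> a = b \/ a <@ b.
Proof.
move=> ab; case: (boolP (b <=@ a)) => ba; [left|by right].
by apply: (go_anti leG); rewrite ab.
Qed.

Lemma goleD2r c a b : (a + c <=@ b + c) = (a <=@ b).
Proof.
apply/idP/idP; last exact: go_add.
by move=> /(go_add leG (- c)); rewrite !addrK.
Qed.

Lemma goleD2l c a b : (c + a <=@ c + b) = (a <=@ b).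
Proof. by rewrite ![c + _]addrC goleD2r. Qed.

Lemma goleD a b c d : a <=@ b -> c <=@ d -> a + c <=@ b + d.
Proof.
by move=> ab cd; apply: (go_trans leG (y := b + c)); rewrite (goleD2r, goleD2l).
Qed.

Lemma golt_leD a b c d : a <@ b -> c <=@ d -> a + c <@ b + d.
Proof.
by move=> ab cd; apply: (golt_le_trans (b := b + c)); rewrite (goleD2r, goleD2l).
Qed.

Lemma gole_subr a b c : (a <=@ c - b) = (a + b <=@ c).
Proof. by rewrite -(goleD2r b) subrK. Qed.

Lemma gole_sub0 a b : (0 <=@ b - a) = (a <=@ b).
Proof. by rewrite gole_subr add0r. Qed.

Lemma goleN a b : (- a <=@ - b) = (b <=@ a).
Proof. by rewrite -gole_sub0 opprK addrC gole_sub0. Qed.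

Lemma goleMn a n : 0 <=@ a -> 0 <=@ a *+ n.
Proof. by move=> a0; elim: n => // n IH; rewrite mulrS -(addr0 0) goleD. Qed.

Lemma gole_sum (s : seq G) : (forall a, a \in s -> 0 <=@ a) ->
  0 <=@ \sum_(a <- s) a.
Proof.
move=> s0; rewrite big_seq; elim/big_rec: _ => // a x /s0 a0 x0.
by rewrite -(addr0 0) goleD.
Qed.

Lemma wo_ind A (P : G -> Prop) : wo A ->
  (forall a, A a -> (forall b, A b -> b <@ a -> P b) -> P a) ->
  forall a, A a -> P a.
Proof.
move=> woA ih a Aa; apply: contrapT => nPa.
have [||b [Ab nPb] bmin] := woA [set b | A b /\ ~ P b].
- by move=> b [].
- by exists a.
apply: nPb; apply: ih => // c Ac cb; apply: contrapT => nPc.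
by have /negP := cb; apply; apply: bmin.
Qed.

Lemma wo_sub A B : B `<=` A -> wo A -> wo B.
Proof. by move=> BA woA C CB; apply: woA; apply: subset_trans CB BA. Qed.

Lemma wo_set1 a : wo [set a].
Proof.
move=> B Ba [b Bb]; exists b => // c Bc.
by rewrite (Ba _ Bb) (Ba _ Bc).
Qed.

Lemma wo_setU A B : wo A -> wo B -> wo (A `|` B).
Proof.
move=> woA woB C CAB [c Cc].
case: (pselect ((C `&` A) !=set0)) => [|nA]; last first.
  apply: woB; last by exists c.
  by move=> d Cd; case: (CAB _ Cd) => // Ad; case: nA; exists d.
case: (pselect ((C `&` B) !=set0)) => [|nB]; last first.
  move=> _; apply: woA; last by exists c.
  by move=> d Cd; case: (CAB _ Cd) => // Bd; case: nB; exists d.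
move=> /(woB _ (@subIsetr _ _ _))[b [Cb Bb] bmin].
move=> /(woA _ (@subIsetr _ _ _))[a [Ca Aa] amin].
case/orP: (go_total leG a b) => ab; [exists a|exists b] => // d Cd.
  case: (CAB _ Cd) => [Ad|Bd]; first exact: amin.
  by apply: (go_trans leG ab); apply: bmin.
case: (CAB _ Cd) => [Ad|Bd]; last exact: bmin.
by apply: (go_trans leG ab); apply: amin.
Qed.

(** Suppose [D] has no minimum. Below each s in [D], choose a decomposition x + y whose first term x
    is the least possible. Passing to an s strictly below x + y cannot lower x, so it lowers y, and
    this cannot go on forever in [B]. *)
Lemma wo_addset A B : wo A -> wo B -> wo (addset A B).
Proof.
move=> woA woB D DAB [d Dd]; apply: contrapT => nmin.
have Dlt x : D x -> exists2 y, D y & y <@ x.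
  move=> Dx; apply: contrapT => nlt; apply: nmin; exists x => // y Dy.
  by apply: contrapT => /negP xy; apply: nlt; exists y.
pose S s := [set x | A x /\ exists y, [/\ B y, D (x + y) & x + y <=@ s]].
have Smin s : D s -> exists x y, [/\ A x, B y, D (x + y), x + y <=@ s &
    forall x', S s x' -> x <=@ x'].
  move=> Ds; have [||x [Ax [y [By Dxy xys]]] xmin] := woA (S s).
  - by move=> x [].
  - by have [x Ax [y By xy]] := DAB _ Ds; exists x; split=> //; exists y; rewrite xy.
  by exists x, y.
suff main : forall y, B y -> forall x, A x -> D (x + y) ->
    (forall x', S (x + y) x' -> x <=@ x') -> False.
  have [x [y [Ax By Dxy xyd xmin]]] := Smin _ Dd.
  apply: (main y By x Ax Dxy) => x' [Ax' [y' [By' Dxy' h]]]; apply: xmin.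
  by split=> //; exists y'; split=> //; apply: (go_trans leG h).
apply: wo_ind => // y By ih x Ax Dxy xmin.
have [s Ds sxy] := Dlt _ Dxy.
have [x' [y' [Ax' By' Dxy' le' xmin']]] := Smin _ Ds.
have xx' : x <=@ x'.
  apply: xmin; split=> //; exists y'; split=> //.
  exact: (go_trans leG le' (golt_le sxy)).
apply: (ih y' By' _ x' Ax' Dxy').
  apply: contra sxy => yy'; apply: (go_trans leG _ le'); exact: goleD.
move=> x'' [Ax'' [y'' [By'' Dxy'' h]]]; apply: xmin'; split=> //.
by exists y''; split=> //; apply: (go_trans leG h).
Qed.

(** The map a -> c - a reverses the order, so nonempty subsets of the fiber have maxima as well as
    minima. Its initial segments are then finite by induction, each adding one point to the segment
    of its predecessor. *)
Lemma wo_fiber_finite A B c : wo A -> wo B ->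
  finite_set [set a | A a /\ B (c - a)].
Proof.
move=> woA woB; set Z := [set a | _].
have woZ : wo Z by apply: wo_sub woA => a [].
have maxZ (C : set G) : C `<=` Z -> C !=set0 ->
    exists2 m, C m & forall a, C a -> a <=@ m.
  move=> CZ [a Ca]; have [||b [d Cd <-] bmin] := woB [set c - a | a in C].
  - by move=> _ [b Cb <-]; case: (CZ _ Cb).
  - by exists (c - a); exists a.
  exists d => // e Ce; have := bmin (c - e).
  by rewrite goleD2l goleN; apply; exists e.
have fin : forall z, Z z -> finite_set [set a | Z a /\ a <=@ z].
  apply: wo_ind => // z Zz ih.
  case: (pselect ([set a | Z a /\ a <@ z] !=set0)) => [ne|em]; last first.
    apply: (@sub_finite_set _ _ [set z]); last exact: finite_set1.
    move=> a [Za az]; case: (gole_eqVlt az) => // h.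
    by case: em; exists a.
  have [|m [Zm mz] mmax] := maxZ _ _ ne; first by move=> a [].
  apply: (@sub_finite_set _ _ ([set z] `|` [set a | Z a /\ a <=@ m])).
    move=> a [Za az]; case: (gole_eqVlt az) => [->|h]; [by left|right].
    by split=> //; apply: mmax.
  by rewrite finite_setU; split; [exact: finite_set1|exact: ih].
case: (pselect (Z !=set0)) => [ne|em]; last first.
  by apply: (@sub_finite_set _ _ set0) => // a Za; case: em; exists a.
have [m Zm mmax] := maxZ _ (@subset_refl _ _) ne.
by apply: sub_finite_set (fin m Zm) => a Za; split=> //; apply: mmax.
Qed.

Lemma sub_sums A : A `<=` sums A.
Proof.
move=> a Aa; exists [:: a]; last by rewrite big_seq1.
by move=> b; rewrite inE => /eqP ->.
Qed.

Lemma sums0 A : sums A 0.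
Proof. by exists [::] => //; rewrite big_nil. Qed.

Lemma sumsD A x y : sums A x -> sums A y -> sums A (x + y).
Proof.
move=> [s sA ->] [t tA ->]; exists (s ++ t); last by rewrite big_cat.
by move=> a; rewrite mem_cat => /orP[/sA|/tA].
Qed.

(* Neumann's lemma, by a minimal bad sequence argument: [bad x] says that the *)
(* sums below x are not well-ordered, and a bad sum [a + v] of minimal length *)
(* below a bad bound has a good tail v.  Choosing the first letter a minimal, *)
(* all later bad sums lie in the sum of A and of the sums below v, which is   *)
(* well-ordered.                                                              *)
Lemma wo_sums A : wo A -> (forall a, A a -> 0 <=@ a) -> wo (sums A).
Proof.
move=> woA A0; set M := sums A.
have M0 x : M x -> 0 <=@ x.
  by move=> [s sA ->]; apply: gole_sum => a /sA/A0.
pose low x := [set y | M y /\ y <=@ x].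
pose bad x := M x /\ ~ wo (low x).
have badD D : D `<=` M -> (forall x, D x -> exists2 y, D y & y <@ x) ->
    D `<=` bad.
  move=> DM Dlt x Dx; split; first exact: DM.
  move=> wol; have [||m [Dm mx] mmin] := wol [set y | D y /\ y <=@ x].
  - by move=> y [/DM My yx].
  - by exists x.
  have [y Dy ym] := Dlt _ Dm; have /negP := ym; apply; apply: mmin.
  by split=> //; apply: (go_trans leG (golt_le ym)).
have nwoD B : ~ wo B -> exists D, [/\ D `<=` B, D !=set0 &
    forall x, D x -> exists2 y, D y & y <@ x].
  move=> nwo; apply: contrapT => nD; apply: nwo => D DB D0.
  apply: contrapT => nmin; apply: nD; exists D; split=> // x Dx.
  apply: contrapT => nlt; apply: nmin; exists x => // y Dy.
  by apply: contrapT => /negP xy; apply: nlt; exists y.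
have badlt x : bad x -> exists2 y, bad y & y <@ x.
  move=> [Mx /nwoD[D [Dx [d Dd] Dlt]]].
  have [y Dy yd] := Dlt _ Dd; exists y.
    by apply: (badD D) => // z /Dx[].
  by apply: (golt_le_trans yd); case: (Dx _ Dd).
pose bw (w : seq G) := (forall a, a \in w -> A a) /\ bad (\sum_(a <- w) a).
pose opt y w := [/\ bw w, \sum_(a <- w) a <@ y &
  forall w', bw w' -> \sum_(a <- w') a <@ y -> (size w <= size w')%N].
have optE y : bad y -> exists w, opt y w.
  move=> by_; have [x bx xy] := badlt _ by_.
  have [[w wA xE] _] := bx.
  pose Q n := `[< exists2 w, bw w /\ \sum_(a <- w) a <@ y & size w = n >].
  have exQ : exists n, Q n.
    by exists (size w); apply/asboolP; exists w; rewrite /bw -?xE.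
  case: (ex_minnP exQ) => n /asboolP[w1 [bw1 w1y] sw1] nmin.
  exists w1; split=> // w' bw' w'y; rewrite sw1; apply: nmin.
  by apply/asboolP; exists w'.
have optC y w : opt y w -> exists a v, [/\ w = a :: v, A a &
    wo (low (\sum_(a <- v) a))].
  case: w => [|a v] [[wA bw_] wy wmin].
    exfalso; have [z [Mz _]] := badlt _ bw_.
    by rewrite big_nil M0.
  have Aa : A a by apply: wA; rewrite mem_head.
  exists a, v; split=> //; apply: contrapT => nwov.
  have vA b : b \in v -> A b by move=> bv; apply: wA; rewrite inE bv orbT.
  (* If the sums below that of v were not well-ordered, v would be a shorter bad word, and its sum
     would still be below y because a >= 0. *)
  suff : (size (a :: v) <= size v)%N by rewrite ltnn.
  apply: wmin; first by split=> //; split=> [|/nwov//]; exists v.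
  apply: gole_lt_trans wy; rewrite big_cons -{1}[\sum_(_ <- _) _]add0r goleD2r.
  exact: A0.
apply: contrapT => /nwoD[D [DM [d Dd] Dlt]].
have bd : bad d by apply: (badD D).
have [||a0 [Aa0 [y0 [v0 [by0 o0]]]] a0min] := woA
  [set a | A a /\ exists y v, bad y /\ opt y (a :: v)].
- by move=> a [].
- have [w ow] := optE _ bd; have [a [v [wE Aa _]]] := optC _ _ ow.
  by exists a; split=> //; exists d, v; rewrite -wE.
have [a1 [v1 [[<- <-] _ wov0]]] := optC _ _ o0.
set s0 := \sum_(a <- a0 :: v0) a.
have bs0 : bad s0 by case: o0 => -[].
pose E := [set x | exists y w, [/\ bad y, y <=@ s0, opt y w & x = \sum_(a <- w) a]].
have [||x [y [w [by_ ys0 ow xE]]] xmin] := wo_addset woA wov0 (_ : E `<=` _).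
- move=> x [y [w [by_ ys0 ow ->]]].
  have [a [v [wE Aa _]]] := optC _ _ ow; rewrite wE big_cons.
  exists a => //; exists (\sum_(b <- v) b) => //; split.
    exists v => // b bv; case: ow => -[wA _] _ _; apply: wA.
    by rewrite wE inE bv orbT.
  have a0a : a0 <=@ a by apply: a0min; split=> //; exists y, v; rewrite -wE.
  apply: contraT => lt0; have: a + \sum_(b <- v) b <@ s0.
    by apply: golt_le_trans ys0; case: ow; rewrite wE big_cons.
  rewrite /s0 big_cons => /negP[]; apply: goleD => //; exact: golt_le.
- have [w ow] := optE _ bs0; exists (\sum_(a <- w) a); exists s0, w.
  by split.
(* The minimum x of [E] is itself bad, so an optimal word below x gives a smaller element of [E]. *)
have bx : bad x by rewrite xE; case: ow => -[].
have [w' ow'] := optE _ bx.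
have /negP[] : \sum_(a <- w') a <@ x by case: ow'.
apply: xmin; exists x, w'; split=> //.
by apply: go_trans ys0 => //; rewrite xE; apply: golt_le; case: ow.
Qed.

End WellOrderedSets.

(** * Splitting additive polynomials *)

Section FrobeniusPowers.
Variables (A : comNzRingType) (p : nat).
Hypothesis pcharA : p \in [pchar A].

Lemma exprD_pchar i (x y : A) : (x + y) ^+ (p ^ i) = x ^+ (p ^ i) + y ^+ (p ^ i).
Proof.
by apply: exprDn_pchar; rewrite pnatX pnatE ?pcharA // (pcharf_prime pcharA).
Qed.

Lemma exprB_pchar i (x y : A) : (x - y) ^+ (p ^ i) = x ^+ (p ^ i) - y ^+ (p ^ i).
Proof. by apply/eqP; rewrite eq_sym subr_eq -exprD_pchar subrK. Qed.

End FrobeniusPowers.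

Section AdditivePolynomials.
Variables (F : fieldType) (p : nat).
Hypothesis pcharF : p \in [pchar F].
Implicit Types (q b D : {poly F}) (m : nat).

Let p_gt1 : (1 < p)%N. Proof. exact: prime_gt1 (pcharf_prime pcharF). Qed.

Definition splits q := exists s : seq F, q %= \prod_(x <- s) ('X - x%:P).

(** Here m counts the admissible exponents [p ^ i], so that [additive 0 q] forces q = 0; it is the
    induction parameter for splitting. *)
Definition additive m q := exists a : nat -> F,
  q = \sum_(i < m) a i *: 'X^(p ^ i).

Lemma splitsM q b : splits q -> splits b -> splits (q * b).
Proof.
move=> [s qs] [t bt]; exists (s ++ t); rewrite big_cat.
by apply: eqp_trans (eqp_mulr _ qs) (eqp_mull _ bt).
Qed.

(** Up to a scalar, [q \Po D] is the product of the [D - x%:P] over the roots x of q. *)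
Lemma splits_comp q D : splits q -> (forall s, splits (D - s%:P)) ->
  splits (q \Po D).
Proof.
move=> [s /eqpf_eq[c c0 ->]] splD; rewrite comp_polyZ rmorph_prod /=.
have [t tE] : splits (\prod_(x <- s) (('X - x%:P) \Po D)).
  elim: s => [|x s IH]; first by exists [::]; rewrite !big_nil eqpxx.
  by rewrite big_cons; apply: splitsM => //; rewrite comp_polyB comp_polyX comp_polyC.
by exists t; apply: eqp_trans tE; rewrite eqp_scale.
Qed.

Let pchar_polyF : p \in [pchar {poly F}].
Proof. by rewrite pchar_poly. Qed.

(** For r = 0 the polynomial is (X - y)^p. Otherwise, if y^p - y = s / r^p, the roots are r y + i r
    with i in the prime field: they are roots because Frobenius fixes i, and distinct because p does
    not divide a difference strictly between 0 and p. *)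
Lemma AS_splits r s :
  (forall s : F, exists y, y ^+ p = s) ->
  (forall s : F, exists y, y ^+ p - y = s) ->
  splits ('X^p - r ^+ p.-1 *: 'X - s%:P).
Proof.
move=> perf AS; have p1E : p = p.-1.+1 by rewrite prednK // ltnW.
have [->|r0] := eqVneq r 0.
  have [y <-] := perf s; exists (nseq p y).
  rewrite expr0n -subn1 subn_eq0 leqNgt p_gt1 scale0r subr0 polyC_exp.
  rewrite big_nseq iter_mulr_1.
  have -> : ('X - y%:P) ^+ p = 'X^p - y%:P ^+ p.
    by have := exprB_pchar pchar_polyF 1 'X y%:P; rewrite expn1.
  exact: eqpxx.
have [y yE] := AS (s / r ^+ p).
have rp : r ^+ p.-1 * r = r ^+ p by rewrite -exprSr -p1E.
have zE : (r * y) ^+ p - r ^+ p.-1 * (r * y) = s.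
  by rewrite exprMn mulrA rp -mulrBr yE mulrC divfK // expf_neq0.
set q := _ - _ - _.
have sq : size q = p.+1.
  rewrite /q -addrA size_polyDl ?size_polyXn // ltnS -opprD size_polyN.
  apply: leq_trans (size_polyD _ _) _; rewrite geq_max size_polyC.
  rewrite (leq_trans (size_scale_leq _ _)) ?size_polyX //=.
  by case: eqP => // _; apply: ltnW.
pose rs := [seq r * y + i%:R * r | i <- iota 0 p].
exists rs.
rewrite {1}(@all_roots_prod_XsubC _ q rs) ?eqp_scale ?lead_coef_eq0
  -?size_poly_eq0 ?sq //.
- by rewrite size_map size_iota.
- apply/allP => _ /mapP[i _ ->]; rewrite /root !hornerE.
  have -> : (r * y + i%:R * r) ^+ p = (r * y) ^+ p + i%:R * r ^+ p.
    have := exprD_pchar pcharF 1 (r * y) (i%:R * r); rewrite expn1 => ->.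
    rewrite [(_%:R * _) ^+ p]exprMn.
    by rewrite -(pFrobenius_autE pcharF i%:R) pFrobenius_aut_nat.
  by rewrite -[X in _ - X]zE mulrDr [_ * (i%:R * r)]mulrCA rp; apply/eqP; ring.
rewrite uniq_rootsE map_inj_in_uniq ?iota_uniq // => i j.
rewrite !mem_iota /= !add0n => ip jp /addrI/(mulIf r0)/eqP.
wlog ij : i j ip jp / (i <= j)%N.
  by move=> H; case/orP: (leq_total i j) => h; [exact: H|rewrite eq_sym => /H->].
rewrite eq_sym -subr_eq0 -natrB // -(dvdn_pcharf pcharF) => /dvdn_leq.
case: (posnP (j - i)%N) => [/eqP|h /(_ isT) le]; last first.
  by have := leq_trans le (leq_subr i j); rewrite leqNgt jp.
by rewrite subn_eq0 => ji _; apply/eqP; rewrite eqn_leq ij.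
Qed.

Lemma additiveD m q b : additive m q -> additive m b -> additive m (q + b).
Proof.
move=> [a ->] [c ->]; exists (fun i => a i + c i); rewrite -big_split.
by apply: eq_bigr => i _; rewrite scalerDl.
Qed.

Lemma additive_sum m (I : Type) (r : seq I) (f : I -> {poly F}) :
  (forall i, additive m (f i)) -> additive m (\sum_(i <- r) f i).
Proof.
move=> fa; elim: r => [|i r [a aE]].
  by exists (fun=> 0); rewrite big_nil big1 // => i _; rewrite scale0r.
by rewrite big_cons; apply: additiveD => //; exists a.
Qed.

Lemma additiveZ m c q : additive m q -> additive m (c *: q).
Proof.
move=> [a ->]; exists (fun i => c * a i); rewrite scaler_sumr.
by apply: eq_bigr => i _; rewrite scalerA.
Qed.

Lemma additive_Xn m i : (i < m)%N -> additive m 'X^(p ^ i).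
Proof.
move=> im; exists (fun j => (j == i)%:R).
rewrite (bigD1 (Ordinal im)) //= eqxx scale1r big1 ?addr0 // => j ji.
by rewrite -[(j : nat) == i]/(j == Ordinal im) (negbTE ji) scale0r.
Qed.

(** Right division by D = X^p - c X for composition. On monomials it iterates X^(p^(i+1)) = D^(p^i)
    + c^(p^i) X^(p^i). *)
Lemma additive_rdiv m c q : additive m.+1 q ->
  exists b e, additive m b /\ q = b \Po ('X^p - c *: 'X) + e *: 'X.
Proof.
set D := 'X^p - _.
have divX i : (i <= m)%N -> exists b e, additive m b /\ 'X^(p ^ i) = b \Po D + e *: 'X.
  elim: i => [_|i IH im].
    exists 0, 1; rewrite comp_poly0 add0r scale1r; split=> //.
    by exists (fun=> 0); rewrite big1 // => i _; rewrite scale0r.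
  have [b [e [bm Xi]]] := IH (ltnW im).
  exists ('X^(p ^ i) + c ^+ (p ^ i) *: b), (c ^+ (p ^ i) * e); split.
    by apply: additiveD; [exact: additive_Xn|exact: additiveZ].
  rewrite comp_polyD comp_polyZ -addrA -scalerA -scalerDr -Xi.
  rewrite rmorphXn /= comp_polyX exprB_pchar // -exprM -expnS exprZn subrK //.
move=> [a ->].
have /choice[b /choice[e be]] : forall i : 'I_m.+1, exists b e,
    additive m b /\ 'X^(p ^ i) = b \Po D + e *: 'X.
  by move=> i; apply: divX; rewrite -ltnS.
exists (\sum_(i < m.+1) a i *: b i), (\sum_(i < m.+1) a i * e i); split.
  by apply: additive_sum => i; apply: additiveZ; case: (be i).
rewrite rmorph_sum scaler_suml -big_split; apply: eq_bigr => i _ /=.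
by rewrite comp_polyZ -scalerA -scalerDr; case: (be i) => _ <-.
Qed.

Lemma additive_coef m (a : nat -> F) i : (i < m)%N ->
  (\sum_(j < m) a j *: 'X^(p ^ j))`_(p ^ i) = a i.
Proof.
move=> im; rewrite coef_sum (bigD1 (Ordinal im)) //= coefZ coefXn eqxx mulr1.
rewrite big1 ?addr0 // => j ji; rewrite coefZ coefXn eqn_exp2l //.
by rewrite eq_sym -[(j : nat) == i]/(j == Ordinal im) (negbTE ji) mulr0.
Qed.

(** If q has degree d, the d + 1 remainders of the X^(p^i) with i <= d lie in a space of dimension
    d, so they satisfy a nontrivial linear relation. *)
Lemma dvdp_additive q : q != 0 ->
  exists m b, [/\ additive m b, b != 0 & q %| b].
Proof.
move=> q0; pose d := (size q).-1; have sq : size q = d.+1.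
  by rewrite /d prednK // size_poly_gt0.
pose M : 'M[F]_(d.+1, d) := \matrix_i poly_rV ('X^(p ^ i) %% q).
have : kermx M != 0.
  rewrite kermx_eq0; apply/negP => /eqP rM.
  by have := rank_leq_col M; rewrite rM ltnn.
case/rowV0Pn => v /sub_kermxP vM v0.
pose a i := v 0 (inord i).
exists d.+1, (\sum_(i < d.+1) a i *: 'X^(p ^ i)); split; first by exists a.
  apply: contraNneq v0 => b0; apply/eqP/rowP => i.
  have := additive_coef a (ltn_ord i); rewrite b0 coef0 /a inord_val mxE.
  by move=> <-.
rewrite /dvdp; apply/eqP; rewrite (big_morph _ (modpD q) (mod0p q)).
under eq_bigr do rewrite modpZl.
rewrite -[LHS](@poly_rV_K _ d); last first.
  apply: leq_trans (size_sum _ _ _) _; apply/bigmax_leqP => i _.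
  by rewrite (leq_trans (size_scale_leq _ _)) // -ltnS -[X in (_ < X)%N]sq ltn_modp.
suff -> : poly_rV (\sum_(i < d.+1) a i *: ('X^(p ^ i) %% q)) = v *m M.
  by rewrite vM linear0.
rewrite linear_sum mulmx_sum_row; apply: eq_bigr => i _.
by rewrite linearZ rowK /a inord_val.
Qed.

Hypothesis perf : forall s : F, exists y, y ^+ p = s.
Hypothesis AS : forall s : F, exists y, y ^+ p - y = s.
Hypothesis addroot : forall m (a : nat -> F) i, (0 < i < m)%N -> a 0%N != 0 ->
  a i != 0 -> exists2 r, r != 0 & \sum_(j < m) a j * r ^+ (p ^ j) = 0.

Lemma additive_splits m q : additive m q -> q != 0 -> splits q.
Proof.
elim: m q => [|m IH] q; first by case=> a ->; rewrite big_ord0 eqxx.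
move=> qm q0; have {}IH b r : additive m b -> q = b \Po ('X^p - r ^+ p.-1 *: 'X) ->
    splits q.
  move=> bm qE; rewrite qE; apply: splits_comp => [|s]; last exact: AS_splits.
  by apply: IH => //; apply: contraNneq q0 => b0; rewrite qE b0 comp_poly0.
have [a qE] := qm.
have [a0|a0] := eqVneq (a 0%N) 0.
  (* Without linear term, q is a polynomial in X^p, which is the inner factor for r = 0. *)
  apply: (IH (\sum_(i < m) a i.+1 *: 'X^(p ^ i)) 0).
    by exists (fun i => a i.+1).
  rewrite expr0n -subn1 subn_eq0 leqNgt p_gt1 scale0r subr0 qE big_ord_recl.
  rewrite a0 scale0r add0r rmorph_sum; apply: eq_bigr => i _ /=.
  by rewrite comp_polyZ comp_Xn_poly -exprM -expnS.
case: (pselect (exists2 i, (0 < i < m.+1)%N & a i != 0)) => [[i im ai]|na]; last first.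
  exists [:: 0]; rewrite big_seq1 subr0 qE big_ord_recl expr1 big1 ?addr0 ?eqp_scale //.
  move=> i _; apply/eqP; rewrite scaler_eq0; apply/orP; left; apply/negPn/negP => ai.
  by apply: na; exists i.+1; first exact: (ltn_ord i).
have [r r0 rE] := addroot im a0 ai.
have [b [e [bm qE']]] := additive_rdiv (r ^+ p.-1) qm.
have [c bE] := bm.
(* The inner factor vanishes at r and b vanishes at 0, so evaluating q at its root r leaves e * r =
   0. *)
suff e0 : e = 0 by apply: (IH b r) => //; rewrite qE' e0 scale0r addr0.
have : q.[r] = 0.
  rewrite qE horner_sum -[RHS]rE; apply: eq_bigr => j _.
  by rewrite hornerZ hornerXn.
rewrite qE' hornerD horner_comp !hornerE -exprSr prednK; last exact: ltnW.
rewrite subrr bE horner_sum big1 ?add0r => [/eqP|j _].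
  by rewrite mulf_eq0 (negbTE r0) orbF => /eqP.
rewrite hornerZ hornerXn expr0n expn_eq0 -leqn0 leqNgt (ltnW p_gt1) /= mulr0 //.
Qed.

(** The monic polynomial q divides a nonzero additive polynomial, which splits; q is therefore a
    product of some of the same linear factors. *)
Lemma closed_field_of_additive : GRing.closed_field_axiom F.
Proof.
move=> n P n0; pose q : {poly F} := 'X^n - \poly_(i < n) P i.
have sq : size q = n.+1.
  by rewrite size_polyDl ?size_polyXn // size_polyN ltnS size_poly.
have q0 : q != 0 by rewrite -size_poly_eq0 sq.
have [m [b [bm b0 qb]]] := dvdp_additive q0.
have [s bs] := additive_splits bm b0.
have [t qt] : {t | q %= \prod_(i <- mask t s) ('X - i%:P)}.
  by apply: dvdp_prod_XsubC; rewrite -(eqp_dvdr _ bs).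
have := eqp_size qt; rewrite sq size_prod_XsubC => -[].
case E : (mask t s) => [|x u] /=; first by move=> h; rewrite h in n0.
move=> _; exists x; have : root q x.
  by rewrite (eqp_root qt) E root_prod_XsubC mem_head.
rewrite /root hornerD hornerN hornerXn subr_eq0 => /eqP ->.
by rewrite horner_poly.
Qed.

End AdditivePolynomials.

(** * Series with supports in a Rayner family *)

(** The sign conditions matter: the multiples of a negative exponent, and the quotients of a
    positive one by the powers of p, decrease forever. *)
Record rayner_family (G : lmodType rat) (le : rel G) (p : nat)
    (Fam : set (set G)) : Prop := RaynerFamily {
  rf_wo : forall A, Fam A -> wo le A;
  rf_sub : forall A B, B `<=` A -> Fam A -> Fam B;
  rf_set1 : forall a, Fam [set a];
  rf_setU : forall A B, Fam A -> Fam B -> Fam (A `|` B);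
  rf_addset : forall A B, Fam A -> Fam B -> Fam (addset A B);
  rf_sums : forall A, Fam A -> (forall a, A a -> le 0 a) -> Fam (sums A);
  rf_div : forall A, Fam A -> Fam [set p%:R^-1 *: a | a in A];
  rf_divs : forall A, Fam A -> (forall a, A a -> ~~ le 0 a) ->
    Fam (\bigcup_i [set (p ^ i)%:R^-1 *: a | a in A]) }.

(** * Cauchy products and recursion along well-ordered supports *)

Section Convolution.
Variables (G : zmodType) (K : fieldType) (le : rel G).
Hypothesis leG : group_order le.
Implicit Types (x y z : G -> K) (a b c g h : G) (A B C : set G).

Definition spt x : set G := [set a | x a != 0].

(** [qs_mul] over an arbitrary group of exponents, with the same convention that a sum with
    infinitely many nonzero terms is 0. *)
Definition conv x y : G -> K := fun c => \sum_(a \in [set: G]) x a * y (c - a).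

Definition one_at0 : G -> K := fun g => (g == 0)%:R.

Lemma supF x A g : spt x `<=` A -> ~ A g -> x g = 0.
Proof. by move=> xA nAg; apply/eqP/negPn/negP => /xA. Qed.

Lemma conv_seq (E : {fset G}) x y c :
  (forall a, a \notin E -> x a * y (c - a) = 0) ->
  conv x y c = \sum_(a <- E) x a * y (c - a).
Proof. exact: fsbigTE. Qed.

Lemma fiber_fset A B c : wo le A -> wo le B ->
  exists E : {fset G}, forall a, a \in E <-> A a /\ B (c - a).
Proof.
move=> woA woB; pose Z := [set a | A a /\ B (c - a)].
have finZ : finite_set Z by exact: (wo_fiber_finite leG).
by exists (fset_set Z) => a; rewrite in_fset_set // in_setE.
Qed.

(** The finite index set depends only on [A], [B] and c, so products of different series can be
    compared term by term. *)
Lemma conv_fiber A B c : wo le A -> wo le B -> exists E : {fset G},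
  (forall a, a \in E <-> A a /\ B (c - a)) /\
  forall x y, spt x `<=` A -> spt y `<=` B ->
    conv x y c = \sum_(a <- E) x a * y (c - a).
Proof.
move=> woA woB; have [E EP] := fiber_fset c woA woB; exists E; split=> // x y xA yB.
apply: conv_seq => a /negP nE; apply/eqP/negPn/negP.
rewrite mulf_eq0 negb_or => /andP[xa ya].
by apply: nE; rewrite EP; split; [exact: xA|exact: yB].
Qed.

Lemma sup_conv x y : spt (conv x y) `<=` addset (spt x) (spt y).
Proof.
move=> c /(@fsbigN1 _ _ _ _ _ _ (fun c a => x a * y (c - a)))[a _].
rewrite mulf_eq0 negb_or => /andP[xa ya].
by exists a => //; exists (c - a) => //; rewrite addrC subrK.
Qed.

Lemma convC x y : conv x y = conv y x.
Proof.
apply/funext => c; rewrite /conv (reindex_fsbigT (fun a => c - a)).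
  by apply: eq_fsbigr => a _; rewrite subKr mulrC.
by exists (fun a => c - a) => a; rewrite subKr.
Qed.

Lemma convDl x y z : wo le (spt x) -> wo le (spt y) -> wo le (spt z) ->
  conv (fun g => x g + y g) z = (fun g => conv x z g + conv y z g).
Proof.
move=> wx wy wz; apply/funext => c.
have [E [_ EP]] := conv_fiber c (wo_setU leG wx wy) wz.
rewrite !EP //; try by move=> a; [left|right].
  by rewrite -big_split; apply: eq_bigr => a _; rewrite mulrDl.
move=> a; rewrite /spt /=; case: (eqVneq (x a) 0) => [->|xa _]; last by left.
by rewrite add0r; right.
Qed.

Lemma conv1l x : conv one_at0 x = x.
Proof.
apply/funext => c; rewrite /conv (fsbigTE [fset 0]%fset) => [|a].
  by rewrite big_seq_fset1 /one_at0 eqxx mul1r subr0.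
by rewrite inE /one_at0 => /negbTE ->; rewrite mul0r.
Qed.

(** At c both sides are the finite double sum of x a * y (d - a) * z (c - d), with a in [A] and the
    partial sum d of exponents in [D]. *)
Lemma convA x y z : wo le (spt x) -> wo le (spt y) -> wo le (spt z) ->
  conv x (conv y z) = conv (conv x y) z.
Proof.
move=> wx wy wz; apply/funext => c.
have [A [inA AP]] := conv_fiber c wx (wo_addset leG wy wz).
have [D [inD DP]] := conv_fiber c (wo_addset leG wx wy) wz.
rewrite AP ?DP //; try exact: sup_conv.
have -> : \sum_(a <- A) x a * conv y z (c - a) =
    \sum_(a <- A) \sum_(d <- D) x a * (y (d - a) * z (c - d)).
  apply: eq_bigr => a _; rewrite -mulr_sumr.
  have [->|xa] := eqVneq (x a) 0; first by rewrite !mul0r.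
  congr (_ * _); rewrite /conv (reindex_fsbigT (fun d => d - a)); last first.
    by exists (fun d => d + a) => d; rewrite ?subrK ?addrK.
  rewrite (fsbigTE D) => [|d /negP nD].
    by apply: eq_bigr => d _; rewrite opprB addrA subrK.
  apply/eqP/negPn/negP; rewrite mulf_eq0 negb_or => /andP[yd zd].
  apply: nD; rewrite inD; split.
    by exists a => //; exists (d - a) => //; rewrite addrC subrK.
  by move: zd; rewrite opprB addrA subrK.
rewrite exchange_big; apply: eq_bigr => d _ /=.
have [->|zd] := eqVneq (z (c - d)) 0.
  by rewrite mulr0 big1 // => a _; rewrite !mulr0.
rewrite (conv_seq (E := A)) ?mulr_suml => [|a /negP nA].
  by apply: eq_bigr => a _; rewrite mulrA.
apply/eqP/negPn/negP; rewrite mulf_eq0 negb_or => /andP[xa yd].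
apply: nA; rewrite inA; split=> //; exists (d - a) => //; exists (c - d) => //.
by rewrite addrC addrA subrK.
Qed.


(** A term with first exponent c needs a <= c and b <= a + b - c, which forces c = a. *)
Lemma conv_lead x y a b :
  (forall h, spt x h -> le a h) -> (forall h, spt y h -> le b h) ->
  conv x y (a + b) = x a * y b.
Proof.
move=> xa yb; rewrite (conv_seq (E := [fset a]%fset)) => [|c].
  by rewrite big_seq_fset1 addrC addKr.
rewrite inE => ca; apply/eqP/negPn/negP; rewrite mulf_eq0 negb_or => /andP[/xa ac /yb].
rewrite gole_subr // addrC goleD2r // => ca'.
by move/negP: ca; apply; apply/eqP/(go_anti leG); rewrite ca'.
Qed.

Lemma sup_conv_ge x y a b :
  (forall h, spt x h -> le a h) -> (forall h, spt y h -> le b h) ->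
  forall h, spt (conv x y) h -> le (a + b) h.
Proof.
by move=> xa yb h /sup_conv[c /xa ac [d /yb bd <-]]; apply: goleD.
Qed.

(* Transfinite recursion along the well-ordered set M. *)
Lemma contraction_fixpoint (M : set G) (Phi : (G -> K) -> (G -> K)) : wo le M ->
  (forall x, spt x `<=` M -> spt (Phi x) `<=` M) ->
  (forall x y g, M g -> spt x `<=` M -> spt y `<=` M ->
     (forall h, ~~ le g h -> x h = y h) -> Phi x g = Phi y g) ->
  exists2 x, spt x `<=` M & Phi x = x.
Proof.
move=> woM PhiM Philt.
pose lt_in h g := M h /\ M g /\ ~~ le g h.
have wf : well_founded lt_in.
  move=> g; case: (pselect (M g)) => [|nM]; last by constructor=> h [_ []].
  by move: g; apply: (wo_ind woM) => g Mg ih; constructor=> h [Mh [_]]; apply: ih.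
(* [Phi] expects a total function, so it is given the values already built below g in [M], extended
   by 0. *)
pose step g (rec : forall h, lt_in h g -> K) : K :=
  if pselect (M g) then
    Phi (fun h => if pselect (lt_in h g) is left r then rec h r else 0) g
  else 0.
have [x xE] : exists x : G -> K, forall g, x g = step g (fun h _ => x h).
  exists (Fix wf (fun=> K) step) => g.
  rewrite Fix_eq // => {}g f f' ff'; rewrite /step; case: pselect => // Mg.
  by congr (Phi _ _); apply/funext => h; case: pselect.
have xM : spt x `<=` M.
  by move=> g; rewrite /spt /= xE /step; case: (pselect (M g)) => //= _; rewrite eqxx.
exists x => //; apply/funext => g.
case: (pselect (M g)) => [Mg|nM]; last first.
  by rewrite (supF xM nM) (supF (PhiM _ xM) nM).
rewrite [RHS]xE /step; case: (pselect (M g)) => //= _; apply: Philt => //.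
  by move=> h; rewrite /spt /=; case: (pselect (lt_in h g)) => [[]//|_]; rewrite eqxx.
move=> h hg; case: (pselect (lt_in h g)) => // nlt; apply: (supF xM) => Mh.
by apply: nlt; split.
Qed.

End Convolution.

(** * The field of series with supports in a Rayner family *)

Section RaynerField.
Variables (G : lmodType rat) (K : closedFieldType) (le : rel G) (p : nat).
Variable Fam : set (set G).
Hypotheses (leG : group_order le) (famP : rayner_family le p Fam).
Hypothesis pcharK : p \in [pchar K].

(** The condition is boolean so that its proofs are irrelevant and series are equal as soon as their
    coefficients are. *)
Definition hseries := {x : G -> K | `[< Fam (spt x) >]}.
Implicit Types (x y z : hseries) (a b g h : G) (c d e : K).
Local Notation S x := (spt (sval x)).

HB.instance Definition _ := Choice.on hseries.

Let p_gt1 : (1 < p)%N. Proof. exact: prime_gt1 (pcharf_prime pcharK). Qed.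

Lemma hsP x : Fam (S x).
Proof. exact/asboolP/(valP x). Qed.
Hint Resolve hsP : core.

Lemma hs_wo x : wo le (S x).
Proof. exact: (rf_wo famP (hsP x)). Qed.
Hint Resolve hs_wo : core.

Lemma hs_ext x y : (forall g, sval x g = sval y g) -> x = y.
Proof.
case: x y => [f famf] [f' famf'] /= /funext ff'.
by move: famf famf'; rewrite ff' => famf famf'; rewrite (bool_irrelevance famf famf').
Qed.

Definition hs (f : G -> K) (famf : Fam (spt f)) : hseries :=
  exist _ f (asboolT famf).

Lemma sup0 : spt (fun=> 0 : K) `<=` [set 0 : G].
Proof. by move=> g; rewrite /spt /= eqxx. Qed.

Lemma supD (f f' : G -> K) : spt (fun g => f g + f' g) `<=` spt f `|` spt f'.
Proof.
move=> g; rewrite /spt /=; case: (eqVneq (f g) 0) => [->|]; last by left.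
by rewrite add0r; right.
Qed.

Lemma supN (f : G -> K) : spt (fun g => - f g) `<=` spt f.
Proof. by move=> g; rewrite /spt /= oppr_eq0. Qed.

Definition hs0 := hs (rf_sub famP sup0 (rf_set1 famP 0)).
Definition hsD x y :=
  hs (rf_sub famP (@supD (sval x) (sval y)) (rf_setU famP (hsP x) (hsP y))).
Definition hsN x := hs (rf_sub famP (@supN (sval x)) (hsP x)).

Fact hsDA : associative hsD.
Proof. by move=> x y z; apply: hs_ext => g; rewrite /= addrA. Qed.
Fact hsDC : commutative hsD.
Proof. by move=> x y; apply: hs_ext => g; rewrite /= addrC. Qed.
Fact hs0D : left_id hs0 hsD.
Proof. by move=> x; apply: hs_ext => g; rewrite /= add0r. Qed.
Fact hsND : left_inverse hs0 hsN hsD.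
Proof. by move=> x; apply: hs_ext => g; rewrite /= addNr. Qed.

HB.instance Definition _ := GRing.isZmodule.Build hseries hsDA hsDC hs0D hsND.

Definition mono_fun (c : K) a : G -> K := fun g => if g == a then c else 0.

Lemma sup_mono c a : spt (mono_fun c a) `<=` [set a].
Proof.
by move=> g; rewrite /spt /mono_fun /=; case: (eqVneq g a) => //; rewrite eqxx.
Qed.

Definition mono c a := hs (rf_sub famP (@sup_mono c a) (rf_set1 famP a)).

Definition hsM x y :=
  hs (rf_sub famP (@sup_conv _ _ (sval x) (sval y)) (rf_addset famP (hsP x) (hsP y))).

Let one_monoE : one_at0 K = mono_fun 1 0 :> (G -> K).
Proof. by apply/funext => g; rewrite /one_at0 /mono_fun; case: eqP. Qed.

Fact hsMA : associative hsM.
Proof. by move=> x y z; apply: hs_ext => g; rewrite /= (convA leG). Qed.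
Fact hsMC : commutative hsM.
Proof. by move=> x y; apply: hs_ext => g; rewrite /= convC. Qed.
Fact hs1M : left_id (mono 1 0) hsM.
Proof. by move=> x; apply: hs_ext => g; rewrite /= -one_monoE conv1l. Qed.
Fact hsMDl : left_distributive hsM hsD.
Proof. by move=> x y z; apply: hs_ext => g; rewrite /= (convDl leG). Qed.
Fact hs1_neq0 : mono 1 0 != 0.
Proof.
apply/eqP => /(congr1 (fun x => sval x 0)) /=; rewrite /mono_fun eqxx.
by move/eqP; rewrite oner_eq0.
Qed.

HB.instance Definition _ := GRing.Zmodule_isComNzRing.Build hseries
  hsMA hsMC hs1M hsMDl hs1_neq0.

Lemma cfD x y g : sval (x + y) g = sval x g + sval y g. Proof. by []. Qed.
Lemma cfN x g : sval (- x) g = - sval x g. Proof. by []. Qed.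
Lemma cf0 g : sval (0 : hseries) g = 0. Proof. by []. Qed.
Lemma cfM x y : sval (x * y) = conv (sval x) (sval y). Proof. by []. Qed.
Lemma cf_sum (I : Type) (r : seq I) (f : I -> hseries) g :
  sval (\sum_(i <- r) f i) g = \sum_(i <- r) sval (f i) g.
Proof. by elim/big_rec2: _ => // i y x _ <-. Qed.

Lemma cf_monoM c a x g : sval (mono c a * x) g = c * sval x (g - a).
Proof.
rewrite cfM (conv_seq (E := [fset a]%fset)) => [|h].
  by rewrite big_seq_fset1 /= /mono_fun eqxx.
by rewrite inE /= /mono_fun => /negbTE ->; rewrite mul0r.
Qed.

Lemma monoM c d a b : mono c a * mono d b = mono (c * d) (a + b).
Proof.
apply: hs_ext => g; rewrite cf_monoM /= /mono_fun subr_eq addrC.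
by case: eqP; rewrite ?mulr0.
Qed.

Lemma monoX c a k : mono c a ^+ k = mono (c ^+ k) (a *+ k).
Proof.
by elim: k => [|k IH]; rewrite ?expr0 ?mulr0n // !exprS IH monoM mulrS.
Qed.

Lemma pchar_hseries : p \in [pchar hseries].
Proof.
rewrite inE (pcharf_prime pcharK) /=; apply/eqP/hs_ext => g.
have -> n : sval (n%:R : hseries) g = sval (1 : hseries) g *+ n.
  by elim: n => // n IH; rewrite !mulrS cfD IH.
exact: mulrn_pchar.
Qed.

Lemma supMS (A B : set G) x y : S x `<=` A -> S y `<=` B -> S (x * y) `<=` addset A B.
Proof.
move=> xA yB g /sup_conv[a xa [b yb <-]].
by exists a; [exact: xA|exists b; [exact: yB|]].
Qed.

Lemma supXS (A : set G) x k : (forall a b, A a -> A b -> A (a + b)) ->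
  S x `<=` A -> S (x ^+ k.+1) `<=` A.
Proof.
move=> AD xA; elim: k => [|k IH]; first by rewrite expr1.
by rewrite exprS => g /(supMS xA IH)[a Aa [b Ab <-]]; apply: AD.
Qed.

Lemma supX_ge x g k : (forall h, S x h -> le g h) ->
  forall h, S (x ^+ k) h -> le (g *+ k) h.
Proof.
move=> xg; elim: k => [|k IH].
  by rewrite expr0 mulr0n => h /sup_mono ->; apply: gole_refl leG _.
by rewrite exprS mulrS; apply: sup_conv_ge.
Qed.

Let powset (A : set G) k := iter k (addset A) [set 0].

Let sup_powset (A : set G) x k : S x `<=` A -> S (x ^+ k) `<=` powset A k.
Proof.
move=> xA; elim: k => [|k IH]; first by rewrite expr0; apply: sup_mono.
by rewrite exprS; apply: supMS.
Qed.

(** In the product of y and [y ^+ k], only finitely many first exponents a contribute at g, the same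
    ones for all y supported in [S x]; by induction the coefficient of [y ^+ k] at each g - a is
    determined by finitely many coefficients. *)
Lemma coefX_finite x k g : exists E : seq G, forall y, S y `<=` S x ->
  {in E, sval y =1 sval x} -> sval (y ^+ k) g = sval (x ^+ k) g.
Proof.
elim: k g => [|k IH] g; first by exists [::] => y; rewrite !expr0.
have wop : wo le (powset (S x) k).
  apply: (rf_wo famP); elim: k {IH} => [|k IH]; first exact: rf_set1 famP _.
  exact: (rf_addset famP).
have [E0 [_ E0P]] := conv_fiber K leG g (@hs_wo x) wop.
have /choice[Ef EfP] := IH.
exists (E0 ++ flatten [seq Ef (g - a) | a <- (E0 : seq G)]) => y yx yE.
rewrite !exprS !cfM !E0P //; try exact: sup_powset.
rewrite big_seq [RHS]big_seq; apply: eq_bigr => a aE0; congr (_ * _).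
  by apply: yE; rewrite mem_cat aE0.
apply: EfP => // b bE; apply: yE; rewrite mem_cat; apply/orP; right.
by apply/flatten_mapP; exists a.
Qed.

Lemma mulrnK_pchar g : (p%:R^-1 *: g) *+ p = g.
Proof.
rewrite -scaler_nat scalerA divff ?scale1r // pnatr_eq0 -lt0n; exact: ltnW.
Qed.

Lemma mulrn_p_inj a b : a *+ p = b *+ p -> a = b.
Proof.
move=> ab; have := congr1 (GRing.scale p%:R^-1) ab.
by rewrite -!scaler_nat !scalerA mulVf ?scale1r // pnatr_eq0 -lt0n; apply: ltnW.
Qed.

(* A single coefficient of [x ^+ p] depends on finitely many coefficients of  *)
(* x, which reduces the claim to the Frobenius map on finite sums of monomials. *)
Lemma cf_frobenius x g : sval (x ^+ p) (g *+ p) = sval x g ^+ p.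
Proof.
have [E EP] := coefX_finite x p (g *+ p).
pose s := undup (g :: E).
pose y := \sum_(a <- s) mono (sval x a) a.
have yE h : sval y h = if h \in s then sval x h else 0.
  rewrite cf_sum /= /mono_fun; case: ifPn => hs_.
    rewrite (bigD1_seq h) ?undup_uniq //= eqxx big1 ?addr0 // => a /negbTE.
    by rewrite eq_sym => ->.
  rewrite big_seq big1 // => a as_; case: eqP => // ha.
  by move: hs_; rewrite ha as_.
rewrite -(EP y); first last.
- by move=> a aE; rewrite yE mem_undup inE aE orbT.
- by move=> a; rewrite /spt /= yE; case: ifP => //; rewrite eqxx.
have -> : y ^+ p = \sum_(a <- s) mono (sval x a ^+ p) (a *+ p).
  rewrite /y -[in LHS](expn1 p) (big_morph _ (exprD_pchar pchar_hseries 1)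
    (expr0n _ _)) expn1.
  rewrite gtn_eqF ?(ltnW p_gt1) //; apply: eq_bigr => a _; exact: monoX.
rewrite cf_sum (bigD1_seq g) ?undup_uniq //= ?mem_undup ?mem_head //.
rewrite {1}/mono_fun eqxx big1 ?addr0 // => a ag; rewrite /mono_fun.
by case: eqP => // /mulrn_p_inj ga; rewrite ga eqxx in ag.
Qed.

(** A solution is a fixed point of x -> x - (T x - y) / e. If two series agree below g, then at g
    their images under T differ by e times their own difference, so the new coefficient at g depends
    only on the coefficients below g. *)
Lemma solve_triangular (M : set G) (T : hseries -> hseries) e : Fam M -> e != 0 ->
  (forall x, S x `<=` M -> S (T x) `<=` M) ->
  (forall x y, S x `<=` M -> S y `<=` M -> T (x - y) = T x - T y) ->
  (forall x g, M g -> S x `<=` M -> (forall h, S x h -> le g h) ->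
     sval (T x) g = e * sval x g) ->
  forall y, S y `<=` M -> exists2 x, S x `<=` M & T x = y.
Proof.
move=> famM e0 TM TB Te y yM.
pose Phi f : G -> K := if pselect (spt f `<=` M) is left fM then
  let x := hs (rf_sub famP fM famM) in fun g => f g - e^-1 * sval (T x - y) g
  else f.
have PhiE x : S x `<=` M -> Phi (sval x) = fun g => sval x g - e^-1 * sval (T x - y) g.
  move=> xM; rewrite /Phi; case: (pselect _) => //= xM'; apply/funext => g.
  by congr (_ - _ * sval (T _ - _) _); apply: hs_ext.
have PhiM x : S x `<=` M -> spt (Phi (sval x)) `<=` M.
  move=> xM g; rewrite PhiE // /spt /= => neq.
  apply: contrapT => nMg; move/eqP: neq; apply.
  by rewrite (supF xM nMg) (supF (TM _ xM) nMg) (supF yM nMg) subr0 mulr0 subr0.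
have [||f fM fE] := contraction_fixpoint (rf_wo famP famM) (Phi := Phi).
- by move=> f fM; apply: (PhiM (hs (rf_sub famP fM famM))).
- move=> f1 f2 g Mg f1M f2M f12.
  pose x1 := hs (rf_sub famP f1M famM); pose x2 := hs (rf_sub famP f2M famM).
  have x12M : S (x1 - x2) `<=` M.
    by move=> h; rewrite /spt /= => neq; apply: contrapT => nMg; move/eqP: neq; apply;
       rewrite (supF f1M nMg) (supF f2M nMg) subrr.
  have x12g h : S (x1 - x2) h -> le g h.
    by apply: contraPT => /f12 f12h; rewrite /spt /= f12h subrr eqxx.
  have := Te _ _ Mg x12M x12g; rewrite TB // => TE.
  rewrite -[f1]/(sval x1) -[f2]/(sval x2) !PhiE //.
  have -> : sval (T x1 - y) g = sval (T x2 - y) g + e * (sval x1 g - sval x2 g).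
    by move: TE; rewrite !cfD !cfN => <-; ring.
  by rewrite mulrDr mulKf //; ring.
pose x := hs (rf_sub famP fM famM); exists x => //; apply/eqP; rewrite -subr_eq0.
apply/eqP/hs_ext => g; have := congr1 (fun f => f g) fE.
rewrite -[f]/(sval x) PhiE //= => /eqP; rewrite -subr_eq0 addrAC subrr add0r oppr_eq0.
by rewrite mulf_eq0 invr_eq0 (negbTE e0) => /eqP.
Qed.

Lemma sup_min x : x != 0 -> exists2 g, S x g & forall h, S x h -> le g h.
Proof.
move=> x0; apply: (@hs_wo x) => //; apply: contrapT => ne; move/eqP: x0; apply.
by apply: hs_ext => g; apply/eqP/negPn/negP => xg; apply: ne; exists g.
Qed.

Lemma sub_sums_addset (A : set G) : addset (sums A) (sums A) `<=` sums A.
Proof. by move=> _ [a Aa [b Ab <-]]; apply: sumsD. Qed.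

(** After a shift the lowest exponent is 0, and multiplication by the shifted series is triangular
    on the monoid generated by its support, with its nonzero constant term on the diagonal. *)
Lemma hs_inv x : x != 0 -> exists y, y * x = 1.
Proof.
move=> /sup_min[g xg gmin]; pose b := mono 1 (- g) * x.
have bE h : sval b h = sval x (h + g) by rewrite cf_monoM mul1r opprK.
have b0 h : S b h -> le 0 h.
  move=> bh; have /gmin : S x (h + g) by move: bh; rewrite /spt /mkset bE.
  by rewrite -{1}[g]add0r goleD2r.
have famM := rf_sums famP (hsP b) b0.
have [|||||z _ zE] := solve_triangular (T := *%R b) (e := sval b 0) famM _ _ _ _
  (y := 1).
- by rewrite bE add0r.
- by move=> y yM h /(supMS (@sub_sums _ _) yM)/sub_sums_addset.
- by move=> y z _ _; rewrite mulrBr.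
- by move=> y h Mh yM yh; rewrite cfM -[h]add0r (conv_lead leG) ?add0r.
- by move=> h /sup_mono ->; apply: sums0.
by exists (mono 1 (- g) * z); rewrite mulrAC -/b zE.
Qed.

Definition hsV x :=
  if pselect (exists y, y * x = 1) is left ex then sval (cid ex) else 0.

Fact hsVx x : x != 0 -> hsV x * x = 1.
Proof. by move=> /hs_inv ex; rewrite /hsV; case: pselect => // ex'; case: cid. Qed.

Fact hsV0 : hsV 0 = 0.
Proof.
rewrite /hsV; case: pselect => // ex; exfalso; have [y] := ex.
by rewrite mulr0 => /eqP; rewrite eq_sym oner_eq0.
Qed.

HB.instance Definition _ := GRing.ComNzRing_isField.Build hseries hsVx hsV0.

(** * Roots of p-th power, Artin-Schreier and additive equations *)

Lemma closed_root (q : {poly K}) : (1 < size q)%N -> exists c, q.[c] = 0.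
Proof.
move=> q1; have /closed_rootP[c /rootP] : size q != 1 by case: (size q) q1 => [|[]].
by exists c.
Qed.

Lemma exists_frobenius_inv : exists rt : K -> K, forall c, rt c ^+ p = c.
Proof.
have /choice[rt rtE] : forall c, exists d, d ^+ p = c; last by exists rt.
move=> c; have [|d dE] := @closed_root ('X^p - c%:P).
  by have p0 := ltnW p_gt1; rewrite size_XnsubC.
by exists d; move/eqP: dE; rewrite !hornerE subr_eq0 => /eqP.
Qed.

(** Exponents are divided by p and coefficients replaced by their p-th roots. *)
Lemma hs_perfect x : exists y, y ^+ p = x.
Proof.
have [rt rtE] := exists_frobenius_inv.
have rt0 : rt 0 = 0.
  by apply/eqP; have := rtE 0; move/eqP; rewrite expf_eq0 => /andP[].
pose f g := rt (sval x (g *+ p)).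
have fS : spt f `<=` [set p%:R^-1 *: a | a in S x].
  move=> g fg; exists (g *+ p); last first.
    by apply: mulrn_p_inj; rewrite mulrnK_pchar.
  by apply: contraNN fg => /eqP xg; rewrite /f xg rt0.
exists (hs (rf_sub famP fS (rf_div famP (hsP x)))); apply: hs_ext => g.
by rewrite -[g]mulrnK_pchar cf_frobenius /= /f rtE.
Qed.

Lemma golt_mulrn g k : (1 < k)%N -> ~~ le g 0 -> ~~ le (g *+ k) g.
Proof.
case: k => [|[|k]] // _ g0.
rewrite mulrSr -[X in le _ X]add0r goleD2r // mulrS -(addr0 0).
by apply: golt_leD => //; apply: goleMn => //; apply: golt_le.
Qed.

Lemma golt_mulrnN g k : (1 < k)%N -> ~~ le 0 g -> ~~ le g (g *+ k).
Proof.
move=> k1 g0; have := @golt_mulrn (- g) k k1.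
by rewrite mulNrn goleN // -{1}oppr0 goleN //; apply.
Qed.

Definition pos_sums (A : set G) : set G := [set g | sums A g /\ ~~ le g 0].

Lemma pos_sumsD (A : set G) a b : pos_sums A a -> pos_sums A b -> pos_sums A (a + b).
Proof.
move=> [Aa a0] [Ab b0]; split; first exact: sumsD.
by rewrite -(addr0 0); apply: golt_leD => //; apply: golt_le.
Qed.

Lemma sums_pos_sumsD (A : set G) a b : (forall a, A a -> le 0 a) ->
  sums A a -> pos_sums A b -> pos_sums A (a + b).
Proof.
move=> A0 Aa [Ab b0]; split; first exact: sumsD.
rewrite addrC -(addr0 0); apply: golt_leD => //.
by case: Aa => s sA ->; apply: gole_sum => // c /sA/A0.
Qed.

Lemma sup_sum (I : finType) (f : I -> hseries) (A : set G) :
  (forall i, S (f i) `<=` A) -> S (\sum_i f i) `<=` A.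
Proof.
move=> fA g sg; apply: contrapT => nA; move/eqP: sg; apply.
by rewrite cf_sum big1 // => i _; apply: (supF (fA i)).
Qed.

(** On series with positive support the operator is triangular: if all exponents of z are at least g
    > 0, those of [z ^+ (p ^ j)] with j > 0 are at least [g *+ (p ^ j)], hence above g, and only the
    constant term of [b 0] acts at g. *)
Lemma hensel_additive m (b : nat -> hseries) y (A : set G) : (0 < m)%N -> Fam A ->
  (forall a, A a -> le 0 a) -> (forall j, (j < m)%N -> S (b j) `<=` A) ->
  sval (b 0%N) 0 != 0 -> S y `<=` pos_sums A ->
  exists2 z : hseries, S z `<=` pos_sums A & \sum_(j < m) b j * z ^+ (p ^ j) = y.
Proof.
move=> m0 famA A0 bA b00 yA; have famM := rf_sums famP famA A0.
have famM' : Fam (pos_sums A) by apply: (rf_sub famP _ famM) => g [].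
have p_pos j : (0 < p ^ j)%N by rewrite expn_gt0 ltnW.
pose T z := \sum_(j < m) b j * z ^+ (p ^ j).
apply: (solve_triangular (T := T) famM' b00) => //.
- move=> x xM; apply: sup_sum => j; have bj := bA j (ltn_ord j).
  rewrite -(prednK (p_pos j)).
  move=> g /(supMS bj (supXS (k := (p ^ j).-1) (@pos_sumsD A) xM))[a Aa [c Mc <-]].
  by apply: sums_pos_sumsD => //; apply: sub_sums.
- move=> x z _ _; rewrite -sumrB; apply: eq_bigr => j _.
  by rewrite -mulrBr (exprB_pchar pchar_hseries).
move=> x g [Ag g0] xM xg; have bge j h : (j < m)%N -> S (b j) h -> le 0 h.
  by move=> jm /(bA j jm)/A0.
rewrite cf_sum (bigD1 (Ordinal m0)) //= expn0 expr1 big1 ?addr0 => [|j j0].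
  by rewrite -{1}[g]add0r (conv_lead leG) // => h; apply: bge.
apply/eqP/negPn/negP => /(sup_conv_ge leG (bge j ^~ (ltn_ord j)) (supX_ge xg)).
rewrite add0r; case: j j0 => -[|j] //= jm _.
by apply/negP/golt_mulrn => //; rewrite -[1%N](expn0 p) ltn_exp2l.
Qed.

Lemma hs_AS_const c : exists y, y ^+ p - y = mono c 0.
Proof.
have [|d dE] := @closed_root ('X^p - 'X - c%:P).
  rewrite -addrA size_polyDl ?size_polyXn ?ltnS ?(ltnW p_gt1) // -opprD size_polyN.
  by rewrite size_XaddC.
exists (mono d 0); rewrite monoX mul0rn; apply: hs_ext => g.
move/eqP: dE; rewrite !hornerE subr_eq0 => /eqP <-.
by rewrite cfD cfN /= /mono_fun; case: eqP => // _; rewrite subrr.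
Qed.

Lemma hs_AS_pos x : (forall g, S x g -> ~~ le g 0) -> exists y, y ^+ p - y = x.
Proof.
(* The additive polynomial X^p - X has linear coefficient -1, a unit. *)
move=> x0; pose b j : hseries := if j == 0%N then - 1 else 1.
pose A := S x `|` [set 0].
have A0 a : A a -> le 0 a.
  by case=> [/x0/(golt_le leG)//|->]; apply: gole_refl.
have bA j : (j < 2)%N -> S (b j) `<=` A.
  move=> _ g; rewrite /b; case: ifP => _ bg; right; last exact: sup_mono bg.
  by have /supN/sup_mono := bg.
have [||z _ zE] := hensel_additive (m := 2) isT
  (rf_setU famP (hsP x) (rf_set1 famP 0)) A0 bA _ _ (y := x).
- by rewrite /b /= /mono_fun eqxx oppr_eq0 oner_eq0.
- by move=> g xg; split; [apply: sub_sums; left|exact: x0].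
exists z; rewrite -[RHS]zE big_ord_recl big_ord1 /b /= expn0 expr1 expn1.
by rewrite mulN1r mul1r addrC.
Qed.

(** Comparing coefficients of y^p = x + y at p g gives y_g as the p-th root of x_(pg) + y_(pg). For
    negative g the exponent p g is below g, so this is a recursion, supported in the quotients of
    [S x] by powers of p. *)
Lemma hs_AS_neg x : (forall g, S x g -> ~~ le 0 g) -> exists y, y ^+ p - y = x.
Proof.
move=> x0; have [rt rtE] := exists_frobenius_inv.
have rt0 : rt 0 = 0.
  by apply/eqP; have := rtE 0; move/eqP; rewrite expf_eq0 => /andP[].
have famN := rf_divs famP (hsP x) x0; set N := \bigcup_i _ in famN.
have N0 g : N g -> ~~ le 0 g.
  move=> [i _ [a /x0 a0 <-]]; apply: contra a0 => /(goleMn leG (p ^ i)).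
  rewrite -scaler_nat scalerA divff ?scale1r // pnatr_eq0 expn_eq0.
  by rewrite -leqn0 leqNgt (ltnW p_gt1).
pose Phi (f : G -> K) : G -> K := fun g => rt (sval x (g *+ p) + f (g *+ p)).
have divN i g a : (p ^ i)%:R^-1 *: a = g *+ p -> S x a -> N g.
  move=> ga xa; exists i.+1 => //; exists a => //; apply: mulrn_p_inj.
  rewrite -ga -scaler_nat scalerA expnS natrM invfM mulrA divff ?mul1r //.
  by rewrite pnatr_eq0 -lt0n ltnW.
have [||f fN fE] := contraction_fixpoint (rf_wo famP famN) (Phi := Phi).
- move=> f fN g; rewrite /spt /Phi /= => neq.
  case: (eqVneq (sval x (g *+ p)) 0) => [xg|xg]; last first.
    by apply: (divN 0%N g (g *+ p)) => //; rewrite expn0 invr1 scale1r.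
  have [|i _ [a xa aE]] := fN (g *+ p); last exact: (divN i g a).
  by apply: contraNN neq => /eqP fg; rewrite xg fg addr0 rt0.
- move=> f1 f2 g Ng _ _ f12; rewrite /Phi f12 //.
  exact/golt_mulrnN/N0.
pose y := hs (rf_sub famP fN famN); exists y.
apply/eqP; rewrite subr_eq; apply/eqP/hs_ext => g.
rewrite -[g]mulrnK_pchar; set h := p%:R^-1 *: g.
by rewrite cf_frobenius cfD /= -{1}fE /Phi rtE.
Qed.

Lemma sup_restr (P : pred G) x : spt (fun g => if P g then sval x g else 0) `<=` S x.
Proof. by move=> g; rewrite /spt /=; case: ifP => //; rewrite eqxx. Qed.

Definition restr (P : pred G) x := hs (rf_sub famP (@sup_restr P x) (hsP x)).

Lemma hs_AS x : exists y, y ^+ p - y = x.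
Proof.
have supP P g : S (restr P x) g -> P g.
  by rewrite /spt /=; case: ifP => //; rewrite eqxx.
have [y1 y1E] := hs_AS_neg (supP (fun g => ~~ le 0 g)).
have [y2 y2E] := hs_AS_pos (supP (fun g => ~~ le g 0)).
have [y3 y3E] := hs_AS_const (sval x 0).
exists (y1 + y2 + y3).
have -> : (y1 + y2 + y3) ^+ p = y1 ^+ p + y2 ^+ p + y3 ^+ p.
  by have D := exprD_pchar pchar_hseries 1; rewrite expn1 in D; rewrite !D.
have -> : y1 ^+ p + y2 ^+ p + y3 ^+ p - (y1 + y2 + y3) =
  (y1 ^+ p - y1) + (y2 ^+ p - y2) + (y3 ^+ p - y3) by ring.
rewrite y1E y2E y3E; apply: hs_ext => g; rewrite !cfD /= /mono_fun.
have [->|g0] := eqVneq g 0; first by rewrite gole_refl //= !add0r.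
rewrite addr0; case: (boolP (le 0 g)) => [l1|l1] /=; last first.
  by rewrite (golt_le leG) //= addr0.
case: (boolP (le g 0)) => l2; last by rewrite add0r.
by case/eqP: g0; apply: (go_anti leG); rewrite l1 l2.
Qed.
(** Dividing the polynomial by X leaves a nonconstant q with constant term [c 0], so a root of q is
    not 0. *)
Lemma additive_root_scalar m (c : nat -> K) i : (0 < i < m)%N -> c 0%N != 0 ->
  c i != 0 -> exists2 d, d != 0 & \sum_(j < m) c j * d ^+ (p ^ j) = 0.
Proof.
move=> /andP[i0 im] c0 ci; have m0 := ltn_trans i0 im.
pose q : {poly K} := \sum_(j < m) c j *: 'X^((p ^ j).-1).
have p_pos j : (0 < p ^ j)%N by rewrite expn_gt0 ltnW.
have qE k : (k < m)%N -> q`_((p ^ k).-1) = c k.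
  move=> km; rewrite coef_sum (bigD1 (Ordinal km)) //= coefZ coefXn eqxx mulr1.
  rewrite big1 ?addr0 // => j jk; rewrite coefZ coefXn -eqSS !prednK // eqn_exp2l //.
  by rewrite eq_sym -[(j : nat) == k]/(j == Ordinal km) (negbTE jk) mulr0.
have [|d dE] := @closed_root q.
  rewrite ltnNge; apply: contraNN ci => sq; rewrite -qE //.
  rewrite nth_default // (leq_trans sq) // -ltnS prednK // -[1%N](expn0 p).
  by rewrite ltn_exp2l.
exists d.
  apply: contraNneq c0 => d0; move: dE; rewrite d0 horner_coef0.
  by rewrite -[0%N]/((p ^ 0).-1) qE // => ->.
have -> : \sum_(j < m) c j * d ^+ (p ^ j) = d * q.[d]; last by rewrite dE mulr0.
rewrite horner_sum mulr_sumr; apply: eq_bigr => j _.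
by rewrite hornerZ hornerXn mulrCA -exprS prednK.
Qed.

(** A nonzero root d of the residue polynomial is corrected by a series z with positive support. By
    additivity of T it is enough that T z = - T d. *)
Lemma additive_root_integral m (b : nat -> hseries) i : (0 < i < m)%N ->
  (forall j g, (j < m)%N -> S (b j) g -> le 0 g) ->
  sval (b 0%N) 0 != 0 -> sval (b i) 0 != 0 ->
  exists2 z, z != 0 & \sum_(j < m) b j * z ^+ (p ^ j) = 0.
Proof.
move=> im bge b0 bi; have m0 : (0 < m)%N by case/andP: im => /ltn_trans h /h.
have [d d0 dE] := additive_root_scalar (c := fun j => sval (b j) 0) im b0 bi.
pose T z := \sum_(j < m) b j * z ^+ (p ^ j).
pose A := \bigcup_(j < m) S (b j).
have famA : Fam A.
  have fam k : Fam (\bigcup_(j < k) S (b j)); last exact: fam.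
  elim: k => [|k IH]; first by apply: (rf_sub famP _ (rf_set1 famP 0)) => g [].
  apply: (rf_sub famP _ (rf_setU famP IH (hsP (b k)))).
  move=> g [j /=]; rewrite ltnS leq_eqVlt => /orP[/eqP->|jm] bg; first by right.
  by left; exists j.
have A0 a : A a -> le 0 a by move=> [j jm /bge]; apply.
have bA j : (j < m)%N -> S (b j) `<=` A by move=> jm g bg; exists j.
pose y := - T (mono d 0).
have TE g : sval (T (mono d 0)) g = \sum_(j < m) sval (b j) g * d ^+ (p ^ j).
  rewrite cf_sum; apply: eq_bigr => j _.
  by rewrite monoX mul0rn mulrC cf_monoM subr0 mulrC.
(* The constant term of T d is 0 because d is a root of the residue polynomial. *)
have yA : S y `<=` pos_sums A.
  move=> g /supN; rewrite /spt /mkset TE => Tg.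
  have Ag : A g.
    apply: contrapT => nA; move/eqP: Tg; apply; rewrite big1 // => j _.
    by rewrite (supF (bA j (ltn_ord j)) nA) mul0r.
  split; first exact: sub_sums.
  apply: contraNN Tg => g0; have -> : g = 0 by apply: (go_anti leG); rewrite g0 A0.
  exact/eqP.
have [z zA zE] := hensel_additive m0 famA A0 bA b0 yA.
exists (mono d 0 + z).
  apply: contraNneq d0 => /(congr1 (fun x => sval x 0)); rewrite cfD cf0.
  rewrite (supF zA) ?addr0 /= /mono_fun ?eqxx; first by move->.
  by case=> _; rewrite gole_refl.
have -> : \sum_(j < m) b j * (mono d 0 + z) ^+ (p ^ j) = T (mono d 0) + T z.
  rewrite -big_split; apply: eq_bigr => j _.
  by rewrite (exprD_pchar pchar_hseries) mulrDr.
by rewrite [T z]zE /y subrr.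
Qed.

(* The substitution [X = t^delta Y] with the largest slope delta makes the    *)
(* coefficients integral, the linear one and another one being units.         *)
Lemma additive_root m (a : nat -> hseries) i : (0 < i < m)%N -> a 0%N != 0 ->
  a i != 0 -> exists2 r, r != 0 & \sum_(j < m) a j * r ^+ (p ^ j) = 0.
Proof.
move=> im a0 ai.
(* [v j] is the lowest exponent of [a j], with default 0 when [a j] is zero. *)
have /choice[v vP] j : exists v, a j != 0 ->
    S (a j) v /\ forall h, S (a j) h -> le v h.
  case: (eqVneq (a j) 0) => [_|/sup_min[v vS vmin]]; first by exists 0.
  by exists v.
(* The exponent delta at which the terms 0 and j have equal order: v 0 + delta = v j + p^j delta. *)
pose slope j := ((p ^ j).-1)%:R^-1 *: (v 0%N - v j).
have slopeE j : (0 < j)%N -> slope j *+ (p ^ j).-1 = v 0%N - v j.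
  move=> j0; rewrite -scaler_nat scalerA divff ?scale1r // pnatr_eq0 -lt0n.
  by rewrite -subn1 subn_gt0 -[1%N](expn0 p) ltn_exp2l.
pose J := [seq j <- iota 1 m.-1 | a j != 0].
have inJ j : (j \in J) = [&& (0 < j)%N, (j < m)%N & a j != 0].
  rewrite mem_filter mem_iota add1n andbC -andbA; congr andb; congr andb.
  by case: (m) im => // /andP[].
have [|||_ /mapP[k kJ ->] kmax] := @total_seq_min _ (fun g h => le h g)
  [seq slope j | j <- J].
- by move=> g h g' hg gh; apply: (go_trans leG gh).
- by move=> g h; apply: go_total leG _ _.
- have : i \in J by rewrite inJ ai andbT.
  by case: J {inJ}.
set dl := slope k in kmax; move: kJ; rewrite inJ => /and3P[k0 km ak].
(* Substituting t^dl z and dividing by t^(dl + v 0), the order of the linear term, shifts the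
   coefficient [a j] by [sh j]. *)
pose sh j := dl *+ (p ^ j) - dl - v 0%N.
pose b j := mono 1 (sh j) * a j.
have bE j g : sval (b j) g = sval (a j) (g - sh j) by rewrite cf_monoM mul1r.
have p_pos j : (0 < p ^ j)%N by rewrite expn_gt0 ltnW.
have shE j : sh j = dl *+ (p ^ j).-1 - v 0%N.
  by rewrite /sh -{1}(prednK (p_pos j)) mulrSr addrK.
have shK j : dl + v 0%N + sh j = dl *+ (p ^ j).
  by rewrite addrC /sh -[_ - _ - _]addrA -opprD subrK.
have [||||z z0 zE] := additive_root_integral (m := m) (b := b) (i := k).
- by rewrite k0.
- move=> j g jm; rewrite /spt /mkset bE => ag.
  have aj : a j != 0 by apply: contraNneq ag => ->.
  have [_ /(_ _ ag)] := vP j aj.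
  rewrite gole_subr // shE addrA => vg; apply: (go_trans leG _ vg).
  case: j {ag} aj jm vg => [|j] aj jm _.
    by rewrite expn0 mulr0n addr0 subrr gole_refl.
  have : le (slope j.+1 *+ (p ^ j.+1).-1) (dl *+ (p ^ j.+1).-1).
    rewrite -(gole_sub0 leG) -mulrnBl; apply: goleMn => //; rewrite gole_sub0 //.
    by apply: kmax; apply: map_f; rewrite inJ aj jm.
  by rewrite slopeE // -(gole_sub0 leG) opprB addrCA addrA.
- rewrite bE shE mulr0n; have [+ _] := vP _ a0.
  by rewrite !sub0r opprK.
- by rewrite bE shE slopeE // sub0r opprB subKr; case: (vP _ ak).
exists (mono 1 dl * z).
  apply: contraNneq z0 => rz; rewrite -[z]mul1r.
  have <- : mono 1 (- dl) * mono 1 dl = 1 by rewrite monoM mulr1 addNr.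
  by rewrite -mulrA rz mulr0.
have -> : \sum_(j < m) a j * (mono 1 dl * z) ^+ (p ^ j) =
    mono 1 (dl + v 0%N) * \sum_(j < m) b j * z ^+ (p ^ j).
  rewrite mulr_sumr; apply: eq_bigr => j _.
  by rewrite exprMn monoX expr1n /b !mulrA monoM mulr1 shK [_ * a j]mulrC.
by rewrite zE mulr0.
Qed.

Definition hs_closed : GRing.closed_field_axiom hseries :=
  closed_field_of_additive pchar_hseries hs_perfect hs_AS additive_root.

HB.instance Definition _ := Field_isAlgClosed.Build hseries hs_closed.

Lemma rayner_closed_field : exists (F : closedFieldType) (phi : F -> (G -> K)),
  [/\ injective phi, range phi = [set f | Fam (spt f)], phi 1 = one_at0 K,
    (forall x y : F, phi (x + y) = fun g => phi x g + phi y g) &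
    forall x y : F, phi (x * y) = conv (phi x) (phi y)].
Proof.
exists hseries, sval; split=> //.
- by move=> x y xy; apply: hs_ext => g; rewrite xy.
- apply/seteqP; split=> [_ [x _ <-]|f famf]; first exact: hsP.
  by exists (hs famf).
Qed.

End RaynerField.

(** * Rational cones and lexicographic orders *)

Section Cones.
Variables (R : realType) (n : nat).
Local Notation V := 'rV[rat]_n.
Local Notation W := 'rV[R]_n.
Implicit Types (a b c w : V) (v u : W) (U : seq V) (us : seq W).

Lemma ratvD a b : ratv R (a + b) = ratv R a + ratv R b.
Proof. exact: map_mxD. Qed.
Lemma ratvN a : ratv R (- a) = - ratv R a.
Proof. exact: map_mxN. Qed.
Lemma ratvB a b : ratv R (a - b) = ratv R a - ratv R b.
Proof. by rewrite ratvD ratvN. Qed.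
Lemma ratvZ q a : ratv R (q *: a) = ratr q *: ratv R a.
Proof. exact: map_mxZ. Qed.
Lemma ratv0 : ratv R 0 = 0 :> W.
Proof. exact: map_mx0. Qed.
Lemma ratv_inj : injective (@ratv R n).
Proof.
move=> a b /rowP ab; apply/rowP => i; have := ab i; rewrite !mxE.
exact: fmorph_inj.
Qed.

Lemma dotvD v v' u : dotv (v + v') u = dotv v u + dotv v' u.
Proof. by rewrite -big_split; apply: eq_bigr => i _; rewrite mxE mulrDl. Qed.
Lemma dotvZ r v u : dotv (r *: v) u = r * dotv v u.
Proof. by rewrite mulr_sumr; apply: eq_bigr => i _; rewrite mxE mulrA. Qed.
Lemma dot0v u : dotv 0 u = 0.
Proof. by rewrite -(scale0r (0 : W)) dotvZ mul0r. Qed.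
Lemma dotvN v u : dotv (- v) u = - dotv v u.
Proof. by rewrite -scaleN1r dotvZ mulN1r. Qed.
Lemma dotvB v v' u : dotv (v - v') u = dotv v u - dotv v' u.
Proof. by rewrite dotvD dotvN. Qed.
Lemma dotv_sum (I : Type) (r : seq I) (f : I -> W) u :
  dotv (\sum_(i <- r) f i) u = \sum_(i <- r) dotv (f i) u.
Proof. by elim/big_rec2: _ => [|i y x _ <-]; rewrite (dot0v, dotvD). Qed.

Lemma lex_le_cons u us v v' : lex_le (u :: us) v v' =
  (dotv v u <= dotv v' u) && ((dotv v' u <= dotv v u) ==> lex_le us v v').
Proof. by rewrite /lex_le /= lexi_cons. Qed.

Lemma lex_le_refl us v : lex_le us v v.
Proof. exact: lexx. Qed.
Lemma lex_le_trans us : transitive (lex_le us).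
Proof. by move=> v v1 v2; apply: le_trans. Qed.
Lemma lex_le_total us : total (lex_le us).
Proof. by move=> v v'; apply: le_total. Qed.
Lemma lex_leD us v v1 v2 : lex_le us v1 v2 -> lex_le us (v1 + v) (v2 + v).
Proof.
elim: us => [|u us IH] //; rewrite !lex_le_cons !dotvD !lerD2r.
by move=> /andP[-> /= /implyP h]; apply/implyP => /h/IH.
Qed.

Definition lexpos us v := lex_le us 0 v.

Lemma lexpos_sub us v v' : lexpos us (v' - v) = lex_le us v v'.
Proof.
apply/idP/idP => [/(lex_leD v)|/(lex_leD (- v))]; first by rewrite add0r subrK.
by rewrite subrr.
Qed.

Lemma lexpos_cons u us v : lexpos (u :: us) v =
  (0 <= dotv v u) && ((dotv v u <= 0) ==> lexpos us v).
Proof. by rewrite /lexpos lex_le_cons dot0v. Qed.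

Lemma lexposD us v v' : lexpos us v -> lexpos us v' -> lexpos us (v + v').
Proof.
rewrite /lexpos => p1 p2; apply: (lex_le_trans p2).
by rewrite -{1}[v']add0r; apply: lex_leD.
Qed.

Lemma lexposZ us r v : 0 <= r -> lexpos us v -> lexpos us (r *: v).
Proof.
rewrite le_eqVlt => /orP[/eqP<-|r0]; first by rewrite scale0r => _; apply: lex_le_refl.
elim: us => [|u us IH] //; rewrite !lexpos_cons dotvZ pmulr_rge0 // pmulr_rle0 //.
by move=> /andP[-> /= /implyP h]; apply/implyP => /h.
Qed.

Lemma lexpos_gt0 u us v : 0 < dotv v u -> lexpos (u :: us) v.
Proof. by move=> v0; rewrite lexpos_cons ltW //= leNgt v0. Qed.

(** * Finitely generated cones and their sections by rational hyperplanes *)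

Definition incone U v := exists2 l : V -> R, (forall w, 0 <= l w) &
  v = \sum_(w <- U) l w *: ratv R w.

Lemma incone0 U : incone U 0.
Proof. by exists (fun=> 0) => //; rewrite big1 // => w _; rewrite scale0r. Qed.

Lemma inconeD U v v' : incone U v -> incone U v' -> incone U (v + v').
Proof.
move=> [l l0 ->] [l' l0' ->]; exists (fun w => l w + l' w) => [w|].
  exact: addr_ge0.
by rewrite -big_split; apply: eq_bigr => w _; rewrite scalerDl.
Qed.

Lemma inconeZ U r v : 0 <= r -> incone U v -> incone U (r *: v).
Proof.
move=> r0 [l l0 ->]; exists (fun w => r * l w) => [w|]; first exact: mulr_ge0.
by rewrite scaler_sumr; apply: eq_bigr => w _; rewrite scalerA.
Qed.

Lemma incone_sum U (I : eqType) (r : seq I) (f : I -> W) :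
  (forall i, i \in r -> incone U (f i)) -> incone U (\sum_(i <- r) f i).
Proof.
move=> fU; rewrite big_seq; elim/big_rec: _ => [|i v /fU]; first exact: incone0.
exact: inconeD.
Qed.

Lemma incone_gen U w : w \in U -> incone U (ratv R w).
Proof.
(* Weights are attached to vectors, not to positions, so a repeated generator counts k times. *)
move=> wU; pose k : R := (count_mem w U)%:R.
have k0 : k != 0 by rewrite pnatr_eq0 -lt0n -has_count has_pred1.
exists (fun w' => if w' == w then k^-1 else 0).
  by move=> w'; case: eqP => // _; rewrite invr_ge0.
rewrite (eq_bigr (fun w' => if w' == w then k^-1 *: ratv R w else 0)); last first.
  by move=> w' _; case: eqP => [->//|_]; rewrite scale0r.
rewrite -big_mkcond big_const_seq iter_addr_0 -scaler_nat scalerA.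
by rewrite divff ?scale1r.
Qed.

Lemma incone_trans U U' v : (forall w, w \in U -> incone U' (ratv R w)) ->
  incone U v -> incone U' v.
Proof.
move=> UU' [l l0 ->]; apply: incone_sum => w wU; apply: inconeZ => //; exact: UU'.
Qed.

Lemma incone_sub U U' v : {subset U <= U'} -> incone U v -> incone U' v.
Proof. by move=> UU'; apply: incone_trans => w /UU'; apply: incone_gen. Qed.

Lemma incone_lexpos us U v : (forall w, w \in U -> lexpos us (ratv R w)) ->
  incone U v -> lexpos us v.
Proof.
move=> Upos [l l0 ->]; rewrite big_seq; elim/big_rec: _ => [|w v' wU v'pos].
  exact: lex_le_refl.
by apply: lexposD => //; apply: lexposZ => //; apply: Upos.
Qed.

Definition rdot a b : rat := \sum_i a 0 i * b 0 i.

Lemma ratr_rdot a b : ratr (rdot a b) = dotv (ratv R a) (ratv R b).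
Proof. by rewrite rmorph_sum; apply: eq_bigr => i _; rewrite rmorphM !mxE. Qed.

(* All vectors of U' and c' are rational combinations of c and of U, which is *)
(* recorded by the linear forms that vanish on them.                          *)
Definition spanned c U c' U' := forall u, dotv (ratv R c) u = 0 ->
  (forall w, w \in U -> dotv (ratv R w) u = 0) ->
  dotv (ratv R c') u = 0 /\ forall w, w \in U' -> dotv (ratv R w) u = 0.

(* One step of the double description method: the generators of the section   *)
(* of a polyhedron [c + cone U] by the hyperplane h, the new base point being *)
(* the smallest vertex.                                                       *)
Lemma cone_cut us U c h : (forall w, w \in U -> lexpos us (ratv R w)) ->
  exists c' U', [/\ spanned c U c' U',
    (forall w, w \in U' -> lexpos us (ratv R w)),
    rdot c' h = 0 /\ (forall w, w \in U' -> rdot w h = 0) &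
    forall a, rdot a h = 0 -> incone U (ratv R (a - c)) ->
      incone U' (ratv R (a - c'))].
Proof.
move=> Upos.
have rdotN a b : rdot a (- b) = - rdot a b.
  by rewrite -sumrN; apply: eq_bigr => i _; rewrite mxE mulrN.
(* As h and - h define the same hyperplane, the base point may be assumed on its nonpositive
   side. *)
wlog c0 : h / rdot c h <= 0.
  move=> H; case: (leP (rdot c h) 0) => [|/ltW c0]; first exact: H.
  have [|c' [U' [sp pos [hc hU] inc]]] := H (- h); first by rewrite rdotN oppr_le0.
  exists c', U'; split=> //.
    split=> [|w /hU]; first by apply/eqP; rewrite -oppr_eq0 -rdotN hc.
    by rewrite rdotN => /eqP; rewrite oppr_eq0 => /eqP.
  by move=> a ha; apply: inc; rewrite rdotN ha oppr0.
have rdotD a b : rdot (a + b) h = rdot a h + rdot b h.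
  by rewrite -big_split; apply: eq_bigr => i _; rewrite mxE mulrDl.
have rdotZ q a : rdot (q *: a) h = q * rdot a h.
  by rewrite mulr_sumr; apply: eq_bigr => i _; rewrite mxE mulrA.
pose f w := rdot w h; pose F w : R := ratr (f w).
pose U0 := [seq w <- U | f w == 0].
pose Up := [seq w <- U | 0 < f w].
pose Um := [seq w <- U | f w < 0].
(* Two generators on opposite sides have a positive combination in the hyperplane. *)
pose Upm := [seq f w *: w' - f w' *: w | w <- Up, w' <- Um].
have UpmP w : w \in Upm -> exists w1 w2, [/\ w1 \in U, w2 \in U, 0 < f w1, f w2 < 0
    & w = f w1 *: w2 - f w2 *: w1].
  case/allpairsP => -[w1 w2] /= []; rewrite !mem_filter => /andP[f1 U1] /andP[f2 U2] ->.
  by exists w1, w2.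
pose Uc := U0 ++ Upm.
have Uc_pos w : w \in Uc -> lexpos us (ratv R w).
  rewrite mem_cat => /orP[|/UpmP[w1 [w2 [U1 U2 f1 f2 ->]]]].
    by rewrite mem_filter => /andP[_ /Upos].
  rewrite -scaleNr ratvD !ratvZ; apply: lexposD; apply: lexposZ;
    by [rewrite ler0q ?oppr_ge0 ltW|apply: Upos].
have Uc_f w : w \in Uc -> f w = 0.
  rewrite mem_cat => /orP[|/UpmP[w1 [w2 [U1 U2 f1 f2 ->]]]].
    by rewrite mem_filter => /andP[/eqP].
  by rewrite /f -scaleNr rdotD !rdotZ -!/(f _); ring.
have Uc_span u : (forall w, w \in U -> dotv (ratv R w) u = 0) ->
    forall w, w \in Uc -> dotv (ratv R w) u = 0.
  move=> Uu w; rewrite mem_cat => /orP[|/UpmP[w1 [w2 [U1 U2 f1 f2 ->]]]].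
    by rewrite mem_filter => /andP[_ /Uu].
  by rewrite ratvB !ratvZ dotvB !dotvZ !Uu // !mulr0 subrr.
have splitU (T : zmodType) (g : V -> T) : \sum_(w <- U) g w =
    \sum_(w <- U0) g w + \sum_(w <- Up) g w + \sum_(w <- Um) g w.
  rewrite !big_filter (bigID (fun w => f w == 0)) -addrA /=; congr (_ + _).
  rewrite (bigID (fun w => 0 < f w)) /=; congr (_ + _); apply: eq_bigl => w.
    by case: (ltgtP (f w) 0).
  by case: (ltgtP (f w) 0).
pose P l : R := \sum_(w <- Up) l w * F w.
pose N l : R := \sum_(w <- Um) l w * - F w.
have balance (l : V -> R) : dotv (\sum_(w <- U) l w *: ratv R w) (ratv R h) = P l - N l.
  rewrite dotv_sum splitU big_seq big1 ?add0r => [|w]; last first.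
    rewrite mem_filter => /andP[/eqP fw _].
    by rewrite dotvZ -ratr_rdot -/(f w) fw rmorph0 mulr0.
  rewrite /P /N -sumrN.
  congr (_ + _); apply: eq_bigr => w _; rewrite dotvZ -ratr_rdot //.
  by rewrite mulrN opprK.
have P_ge0 (l : V -> R) : (forall w, 0 <= l w) -> 0 <= P l.
  move=> l0; rewrite /P big_seq; apply: sumr_ge0 => w.
  rewrite mem_filter => /andP[fw _].
  by rewrite mulr_ge0 // ler0q ltW.
have N_ge0 (l : V -> R) : (forall w, 0 <= l w) -> 0 <= N l.
  move=> l0; rewrite /N big_seq; apply: sumr_ge0 => w.
  rewrite mem_filter => /andP[fw _].
  by rewrite mulr_ge0 // oppr_ge0 lerq0 ltW.
have U0_cone (l : V -> R) : (forall w, 0 <= l w) ->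
    incone Uc (\sum_(w <- U0) l w *: ratv R w).
  move=> l0; apply: incone_sum => w wU; apply: inconeZ => //; apply: incone_gen.
  by rewrite mem_cat wU.
(* The weight of each generator in [Um] is shared among those of [Up] in proportion to their
   contributions to [P l]. All of [Um] is thereby paired with the fraction [N l / P l] of [Up]. *)
have pm_cone (l : V -> R) : (forall w, 0 <= l w) -> 0 < P l ->
    incone Uc (\sum_(w <- Um) l w *: ratv R w +
      (N l / P l) *: \sum_(w <- Up) l w *: ratv R w).
  move=> l0 P0; have Pn0 : P l != 0 by rewrite gt_eqF.
  have -> : \sum_(w <- Um) l w *: ratv R w =
      \sum_(w1 <- Up) \sum_(w2 <- Um) (l w1 * F w1 / P l * l w2) *: ratv R w2.
    rewrite exchange_big; apply: eq_bigr => w2 _ /=.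
    by rewrite -scaler_suml -mulr_suml -mulr_suml -/(P l) divff // mul1r.
  have -> : (N l / P l) *: \sum_(w <- Up) l w *: ratv R w =
      \sum_(w1 <- Up) \sum_(w2 <- Um) (l w1 * (l w2 * - F w2) / P l) *: ratv R w1.
    rewrite scaler_sumr; apply: eq_bigr => w1 _; rewrite -scaler_suml scalerA.
    by congr (_ *: _); rewrite -mulr_suml -mulr_sumr -/(N l); ring.
  rewrite -big_split; apply: incone_sum => w1 w1U /=.
  rewrite -big_split; apply: incone_sum => w2 w2U /=.
  have -> : (l w1 * F w1 / P l * l w2) *: ratv R w2 +
      (l w1 * (l w2 * - F w2) / P l) *: ratv R w1 =
      (l w1 * l w2 / P l) *: ratv R (f w1 *: w2 - f w2 *: w1).
    rewrite ratvB !ratvZ -/(F w1) -/(F w2) -scaleNr scalerDr !scalerA.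
    by congr (_ *: _ + _ *: _); ring.
  apply: inconeZ; first by rewrite divr_ge0 ?mulr_ge0 // ltW.
  by apply: incone_gen; rewrite mem_cat; apply/orP; right; apply: allpairs_f.
have dotac a : rdot a h = 0 -> dotv (ratv R (a - c)) (ratv R h) = - F c.
  by move=> ha; rewrite ratvB dotvB -!ratr_rdot ha rmorph0 sub0r.
move: c0; rewrite le_eqVlt => /orP[/eqP c0|c0].
  exists c, Uc; split=> //.
    by move=> u cu Uu; split=> //; apply: Uc_span.
  move=> a ha [l l0 E]; rewrite E.
  have PN : P l = N l.
    apply/eqP; rewrite -subr_eq0 -balance -E dotac // /F /f c0 rmorph0 oppr0 //.
  have := P_ge0 l l0; rewrite le_eqVlt => /orP[/eqP P0|P0]; last first.
    rewrite splitU -addrA; apply: inconeD; first exact: U0_cone.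
    have := pm_cone l l0 P0; rewrite -PN divff ?gt_eqF // scale1r addrC //.
  (* Here P = N = 0, and both are sums of nonnegative terms. *)
  have lz w : w \in U -> f w != 0 -> l w = 0.
    move=> wU; rewrite neq_lt => /orP[] fw.
      have /eqP : N l = 0 by rewrite -PN -P0.
      rewrite /N big_seq psumr_eq0 => [/allP/(_ w)|w']; last first.
        by rewrite mem_filter => /andP[fw' _]; rewrite mulr_ge0 // oppr_ge0 lerq0 ltW.
      rewrite mem_filter fw wU => /(_ isT); rewrite mulf_eq0 oppr_eq0.
      by rewrite /= [F w == 0]fmorph_eq0 (lt_eqF fw) orbF => /eqP.
    have /eqP : P l = 0 by [].
    rewrite /P big_seq psumr_eq0 => [/allP/(_ w)|w']; last first.
      by rewrite mem_filter => /andP[fw' _]; rewrite mulr_ge0 // ler0q ltW.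
    rewrite mem_filter fw wU => /(_ isT); rewrite mulf_eq0.
    by rewrite /= [F w == 0]fmorph_eq0 (gt_eqF fw) orbF => /eqP.
  rewrite splitU [X in _ + X + _]big_seq [X in _ + X]big_seq.
  rewrite [X in _ + X + _]big1 ?[X in _ + X]big1 ?addr0; first exact: U0_cone.
    by move=> w; rewrite mem_filter => /andP[fw wU]; rewrite lz ?scale0r // lt_eqF.
  by move=> w; rewrite mem_filter => /andP[fw wU]; rewrite lz ?scale0r // gt_eqF.
have Fc0 : F c < 0 by rewrite ltrq0.
have P_gt0 a (l : V -> R) : rdot a h = 0 -> (forall w, 0 <= l w) ->
    ratv R (a - c) = \sum_(w <- U) l w *: ratv R w -> P l = N l - F c /\ 0 < P l.
  move=> ha l0 E; have PE : P l = N l - F c.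
    by apply/eqP; rewrite addrC -subr_eq -balance -E dotac.
  by split=> //; rewrite PE ltr_wpDl ?N_ge0 // oppr_gt0.
(* The point where the ray from c in direction w meets the hyperplane. *)
pose vert w := c - (f c / f w) *: w.
case UpE : Up => [|w0 Up'].
  (* Without an upward generator the section is empty. *)
  exists 0, [::]; split=> //.
  - by move=> u _ _; rewrite ratv0 dot0v.
  - by split=> //; rewrite /rdot big1 // => i _; rewrite mxE mul0r.
  move=> a ha [l l0 E]; have [_] := P_gt0 a l ha l0 E.
  by rewrite /P UpE big_nil ltxx.
have [|||c' /mapP[w1 w1Up c'E] c'min] := @total_seq_min _
  (fun a b => lex_le us (ratv R a) (ratv R b)) [seq vert w | w <- Up].
- by move=> a b d; apply: lex_le_trans.
- by move=> a b; apply: lex_le_total.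
- by rewrite UpE.
(* The other vertices are reached from the smallest one along these differences, which are positive
   by minimality. *)
pose Uv := [seq vert w - c' | w <- Up].
have UvP w : w \in Uv -> exists w2, w2 \in Up /\ w = vert w2 - c'.
  by case/mapP => w2 w2U ->; exists w2.
have vert_span u : dotv (ratv R c) u = 0 ->
    (forall w, w \in U -> dotv (ratv R w) u = 0) ->
    forall w, w \in Up -> dotv (ratv R (vert w)) u = 0.
  move=> cu Uu w; rewrite mem_filter => /andP[_ wU].
  by rewrite ratvB ratvZ dotvB dotvZ cu Uu // mulr0 subrr.
have vert_f w : w \in Up -> f (vert w) = 0.
  rewrite mem_filter => /andP[fw _]; rewrite /f /vert -scaleNr rdotD rdotZ -!/(f _).
  by rewrite mulNr divfK ?subrr // gt_eqF.
exists c', (Uc ++ Uv); split.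
- move=> u cu Uu; split; first by rewrite c'E vert_span.
  move=> w; rewrite mem_cat => /orP[|/UvP[w2 [w2U ->]]]; first exact: Uc_span.
  by rewrite ratvB dotvB c'E !vert_span // subrr.
- move=> w; rewrite mem_cat => /orP[/Uc_pos//|/UvP[w2 [w2U ->]]].
  by rewrite ratvB lexpos_sub; apply: c'min; apply: map_f.
- have c'f : rdot c' h = 0 by rewrite c'E; apply: vert_f.
  split=> // w.
  rewrite mem_cat => /orP[/Uc_f//|/UvP[w2 [w2U ->]]].
  by rewrite -scaleN1r rdotD rdotZ c'f mulr0 addr0; apply: vert_f.
move=> a ha [l l0 E]; have [PE P0] := P_gt0 a l ha l0 E.
have Pn0 : P l != 0 by rewrite gt_eqF.
(* The weights [l w * F w / P l] add up to 1. The fraction [- F c / P l] of [Up] thus carries c to a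
   convex combination of the vertices, and the remaining fraction [N l / P l] is paired with
   [Um]. *)
have vertE : \sum_(w <- Up) (l w * F w / P l) *: ratv R (vert w - c') =
    ratv R (c - c') + (- F c / P l) *: \sum_(w <- Up) l w *: ratv R w.
  have -> : ratv R (c - c') = \sum_(w <- Up) (l w * F w / P l) *: ratv R (c - c').
    by rewrite -scaler_suml -mulr_suml -/(P l) divff // scale1r.
  rewrite scaler_sumr -big_split big_seq [RHS]big_seq; apply: eq_bigr => w.
  rewrite mem_filter => /andP[fw _]; have Fw : F w != 0 by rewrite fmorph_eq0 gt_eqF.
  have -> : vert w - c' = (c - c') - (f c / f w) *: w by rewrite /vert addrAC.
  rewrite (ratvB (c - c')) ratvZ scalerBr -scaleNr !scalerA; congr (_ + _ *: _).
  by rewrite fmorph_div -/(F c) -/(F w); field; rewrite Pn0 Fw.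
have -> : ratv R (a - c') = \sum_(w <- U0) l w *: ratv R w +
    (\sum_(w <- Um) l w *: ratv R w + (N l / P l) *: \sum_(w <- Up) l w *: ratv R w) +
    \sum_(w <- Up) (l w * F w / P l) *: ratv R (vert w - c').
  have -> : a - c' = (a - c) + (c - c') by rewrite addrA subrK.
  rewrite vertE ratvD E splitU; set X0 := \sum_(w <- U0) _; set Xp := \sum_(w <- Up) _.
  set Xm := \sum_(w <- Um) _; set Y := ratv R (c - c').
  rewrite -{1}[Xp]scale1r.
  have -> : 1 = N l / P l + (- F c / P l) :> R by rewrite -mulrDl -PE divff.
  rewrite scalerDl -!addrA [in RHS](addrCA Xm); congr (_ + (_ + _)).
  by rewrite addrCA [_ *: _ + _]addrC.
apply: inconeD; last first.
  apply: incone_sum => w wU; apply: inconeZ.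
    move: wU; rewrite mem_filter => /andP[fw _].
    by apply: divr_ge0; [apply: mulr_ge0 => //; rewrite ler0q ltW|exact: ltW].
  by apply: incone_gen; rewrite mem_cat; apply/orP; right; apply: map_f.
apply: (@incone_sub Uc); first by move=> w wU; rewrite mem_cat wU.
by apply: inconeD; [exact: U0_cone|exact: pm_cone].
Qed.
Lemma rdot_eq0 a b : rdot a b = 0 <-> dotv (ratv R a) (ratv R b) = 0.
Proof.
rewrite -ratr_rdot; split=> [->|/eqP]; first by rewrite rmorph0.
by rewrite fmorph_eq0 => /eqP.
Qed.

Lemma cone_cuts us (H : seq V) U c : (forall w, w \in U -> lexpos us (ratv R w)) ->
  exists c' U', [/\ spanned c U c' U',
    (forall w, w \in U' -> lexpos us (ratv R w)),
    (forall h, h \in H -> rdot c' h = 0 /\ (forall w, w \in U' -> rdot w h = 0)) &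
    forall a, (forall h, h \in H -> rdot a h = 0) -> incone U (ratv R (a - c)) ->
      incone U' (ratv R (a - c'))].
Proof.
elim: H U c => [|h H IH] U c Upos.
  by exists c, U; split.
have [c1 [U1 [sp1 pos1 [hc1 hU1] in1]]] := cone_cut c h Upos.
have [c2 [U2 [sp2 pos2 H2 in2]]] := IH U1 c1 pos1.
exists c2, U2; split=> //.
- by move=> u cu Uu; have [cu1 Uu1] := sp1 u cu Uu; apply: sp2.
- move=> h'; rewrite inE => /orP[/eqP->|/H2//].
  (* The later cuts preserve the equation of h, by [spanned]. *)
  have [||hc2 hU2] := sp2 (ratv R h); try by move/rdot_eq0: hc1.
    by move=> w /hU1/rdot_eq0.
  by split=> [|w /hU2 hw]; apply/rdot_eq0.
move=> a aH Ua; apply: in2.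
  by move=> h' hH; apply: aH; rewrite inE hH orbT.
by apply: in1 => //; apply: aH; rewrite mem_head.
Qed.

(* Take a matrix of maximal rank among the rational matrices whose rows are    *)
(* killed by u; the columns of its cokernel are the wanted forms.             *)
Lemma rational_kernel u : exists H : seq V, forall a,
  (dotv (ratv R a) u = 0) <-> (forall h, h \in H -> rdot a h = 0).
Proof.
pose Q r := `[< exists k (M : 'M[rat]_(k, n)), \rank M = r /\
  forall i, dotv (ratv R (row i M)) u = 0 >].
have exQ : exists r, Q r.
  by exists 0%N; apply/asboolP; exists 0%N, 0; rewrite mxrank0; split=> // -[].
have Qle r : Q r -> (r <= n)%N.
  by move=> /asboolP[k [M [<- _]]]; apply: rank_leq_col.
case: (ex_maxnP exQ Qle) => r /asboolP[k [M [Mr Mu]]] rmax.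
have rdotE a (j : 'I_n) : rdot a (col j (cokermx M))^T = (a *m cokermx M) 0 j.
  by rewrite mxE; apply: eq_bigr => i _; rewrite !mxE.
exists [seq (col j (cokermx M))^T | j <- enum 'I_n] => a.
split=> [au h /mapP[j _ ->]|aH].
  rewrite rdotE; suff : (a <= M)%MS by rewrite submxE => /eqP ->; rewrite mxE.
  have sub : (M <= col_mx M a)%MS by rewrite -addsmxE addsmxSl.
  have : (col_mx M a <= M)%MS.
    rewrite -(geq_leqif (mxrank_leqif_sup sub)) Mr; apply: rmax; apply/asboolP.
    exists (k + 1)%N, (col_mx M a); split=> // i.
    case: (split_ordP i) => i' ->; first by rewrite rowKu.
    by rewrite rowKd row_id.
  by rewrite -addsmxE addsmx_sub => /andP[].
have /submxP[D ->] : (a <= M)%MS.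
  rewrite submxE; apply/eqP/rowP => j; rewrite -rdotE mxE; apply: aH.
  by apply: map_f; rewrite mem_enum.
rewrite mulmx_sum_row.
have -> : ratv R (\sum_i D 0 i *: row i M) = \sum_i ratr (D 0 i) *: ratv R (row i M).
  by rewrite /ratv raddf_sum; apply: eq_bigr => i _; exact: ratvZ.
by rewrite dotv_sum big1 // => i _; rewrite dotvZ Mu mulr0.
Qed.

(* If [u . c <= 0], each generator w is replaced by [w + q c] with q rational, *)
(* small enough to keep [w + q c] positive, and large enough for c to be      *)
(* absorbed by the generators wherever [u . a >= e].                          *)
Lemma positive_cone_step us u (A : set V) c U e : 0 < e ->
  (forall w, w \in U -> lexpos (u :: us) (ratv R w)) ->
  (forall a, A a -> e <= dotv (ratv R a) u) ->
  (forall a, A a -> incone U (ratv R (a - c))) ->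
  exists U', [/\ forall w, w \in U' -> lexpos (u :: us) (ratv R w),
    spanned c U c U' & forall a, A a -> incone U' (ratv R a)].
Proof.
move=> e0 Upos Ae AU; set l := fun a => dotv (ratv R a) u.
have addc a : ratv R a = ratv R c + ratv R (a - c) by rewrite ratvB addrC subrK.
have [lc|lc] := ltP 0 (l c).
  exists (c :: U); split.
  - by move=> w; rewrite inE => /orP[/eqP->|/Upos//]; apply: lexpos_gt0.
  - by move=> u' cu Uu; split=> // w; rewrite inE => /orP[/eqP->|/Uu].
  move=> a Aa; rewrite addc; apply: inconeD.
    by apply: incone_gen; rewrite mem_head.
  by apply: incone_sub (AU a Aa) => w; rewrite inE orbC => ->.
have ec0 : 0 < e - l c by rewrite ltr_wpDr // oppr_ge0.
have /choice[q qP] w : exists q : rat, w \in U ->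
    [/\ 0 <= q, lexpos (u :: us) (ratv R (w + q *: c)) & l w <= ratr q * (e - l c)].
  case: (boolP (w \in U)) => [wU|]; last by exists 0.
  have := Upos w wU; rewrite lexpos_cons => /andP[lw0 _].
  move: lw0; rewrite le_eqVlt => /orP[/eqP lw0|lw0].
    exists 0 => _; rewrite scale0r addr0; split=> //; first exact: Upos.
    by rewrite /l -lw0 rmorph0 mul0r.
  (* The lower bound x lets q absorb c. The width t solves l w + (x + t) l c = t, so w + q c keeps a
     positive value up to the end of the interval. *)
  pose x := l w / (e - l c); pose t := l w * e / (e - l c) / (1 - l c).
  have lc1 : 0 < 1 - l c by lra.
  have t0 : 0 < t by rewrite !divr_gt0 ?mulr_gt0.
  have [q] : exists q : rat, ratr q \in `]x, x + t[.
    by apply: rat_in_itvoo; rewrite ltrDl.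
  rewrite in_itv /= => /andP[xq qt]; exists q => _.
  have x0 : 0 <= x by rewrite divr_ge0 // ltW.
  have q0 : 0 <= q by rewrite -(ler0q R) (le_trans x0) // ltW.
  split=> //; last by rewrite -ler_pdivrMr // ltW.
  apply: lexpos_gt0; rewrite ratvD ratvZ dotvD dotvZ -/(l w) -/(l c).
  have : (x + t) * l c <= ratr q * l c by rewrite ler_wnM2r // ltW.
  have : l w + (x + t) * l c = t by rewrite /x /t; field; rewrite !gt_eqF.
  lra.
exists (U ++ [seq w + q w *: c | w <- U]); split.
- move=> w; rewrite mem_cat => /orP[/Upos//|/mapP[w' w'U ->]].
  by case: (qP w' w'U).
- move=> u' cu Uu; split=> // w; rewrite mem_cat => /orP[/Uu//|/mapP[w' w'U ->]].
  by rewrite ratvD ratvZ dotvD dotvZ cu Uu // mulr0 addr0.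
move=> a Aa; have [k k0 E] := AU a Aa.
(* With a - c the sum of the k w * w, the combination of the w + q w c with weights k w / C is (a -
   c) / C + c. What remains of a is (1 - 1/C)(a - c), so C >= 1 is needed. *)
pose C : R := \sum_(w <- U) k w * ratr (q w).
have C1 : 1 <= C.
  rewrite -(ler_pM2r ec0) mul1r; apply: (@le_trans _ _ (dotv (ratv R (a - c)) u)).
    by rewrite ratvB dotvB lerD2r Ae.
  rewrite E dotv_sum mulr_suml big_seq [X in _ <= X]big_seq; apply: ler_sum => w wU.
  by rewrite dotvZ -mulrA ler_wpM2l //; case: (qP w wU).
have C0 : 0 < C by apply: lt_le_trans C1.
have -> : ratv R a = \sum_(w <- U) (C^-1 * k w) *: ratv R (w + q w *: c) +
    (1 - C^-1) *: ratv R (a - c).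
  have -> : \sum_(w <- U) (C^-1 * k w) *: ratv R (w + q w *: c) =
      C^-1 *: ratv R (a - c) + ratv R c.
    rewrite E scaler_sumr; have -> : ratv R c =
        \sum_(w <- U) (C^-1 * k w * ratr (q w)) *: ratv R c.
      rewrite -scaler_suml (eq_bigr (fun w => C^-1 * (k w * ratr (q w)))) => [|w _].
        by rewrite -mulr_sumr -/C mulVf ?scale1r // gt_eqF.
      by rewrite -mulrA.
    rewrite -big_split; apply: eq_bigr => w _ /=.
    by rewrite ratvD ratvZ scalerDr !scalerA.
  by rewrite scalerBl scale1r addrC addrA subrK addrC -addc.
apply: inconeD.
  apply: incone_sum => w wU; apply: inconeZ; first by rewrite mulr_ge0 // invr_ge0 ltW.
  by apply: incone_gen; rewrite mem_cat; apply/orP; right; apply: map_f.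
apply: inconeZ; first by rewrite subr_ge0 invf_le1.
by apply: incone_sub (AU a Aa) => w; rewrite mem_cat => ->.
Qed.

Definition lex_rat us : rel V := fun a b => lex_le us (ratv R a) (ratv R b).

(** The conclusion on [spanned] makes the induction work: generators found for the slice where u
    vanishes must stay in that slice, since the induction hypothesis gives positivity only for the
    remaining forms. *)
Lemma positive_cone us (A : set V) c U :
  (forall w, w \in U -> lexpos us (ratv R w)) ->
  (forall a, A a -> lexpos us (ratv R a)) -> wo (lex_rat us) A ->
  (forall a, A a -> incone U (ratv R (a - c))) ->
  exists U', [/\ forall w, w \in U' -> lexpos us (ratv R w),
    spanned c U c U' & forall a, A a -> incone U' (ratv R a)].
Proof.
elim: us A c U => [|u us IH] A c U Upos Apos woA AU.
  exists (c :: U); split=> //.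
    by move=> u cu Uu; split=> // w; rewrite inE => /orP[/eqP->|/Uu].
  move=> a Aa; rewrite -[a](subrK c) addrC ratvD; apply: inconeD.
    by apply: incone_gen; rewrite mem_head.
  by apply: incone_sub (AU a Aa) => w; rewrite inE orbC => ->.
pose A1 := [set a | A a /\ 0 < dotv (ratv R a) u].
have [U1 [U1pos U1sp U1A]] : exists U', [/\
    forall w, w \in U' -> lexpos (u :: us) (ratv R w),
    spanned c U c U' & forall a, A1 a -> incone U' (ratv R a)].
  case: (pselect (A1 !=set0)) => [ne|em]; last first.
    by exists [::]; split=> // a A1a; case: em; exists a.
  have [|b [Ab bu] bmin] := woA A1 _ ne; first by move=> a [].
  (* The least element b of [A1] provides the lower bound u . b > 0. *)
  apply: (positive_cone_step bu Upos) => [a /bmin|a [/AU//]].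
  by rewrite /lex_rat lex_le_cons => /andP[].
have [H HP] := rational_kernel u.
have [c2 [U2 [sp2 pos2 H2 in2]]] := cone_cuts H c Upos.
pose A0 := [set a | A a /\ dotv (ratv R a) u = 0].
have c2u : dotv (ratv R c2) u = 0 by apply/HP => h /H2[].
have U2u w : w \in U2 -> dotv (ratv R w) u = 0.
  by move=> wU; apply/HP => h /H2[_]; apply.
have [||||U0 [U0pos U0sp U0A]] := IH A0 c2 U2.
- by move=> w wU; have := pos2 w wU; rewrite lexpos_cons U2u // lexx.
- by move=> a [/Apos + au]; rewrite lexpos_cons au lexx.
- move=> B BA0 B0; have [|b Bb bmin] := woA B _ B0; first by move=> a /BA0[].
  exists b => // a Ba; have := bmin a Ba; rewrite /lex_rat lex_le_cons.
  by have [_ ->] := BA0 _ Ba; have [_ ->] := BA0 _ Bb; rewrite lexx.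
- by move=> a [Aa au]; apply: in2; [exact/HP|exact: AU].
exists (U1 ++ U0); split.
- move=> w; rewrite mem_cat => /orP[/U1pos//|wU].
  have [_ U0u] := U0sp u c2u U2u.
  by rewrite lexpos_cons U0u // lexx U0pos.
- move=> u' cu Uu; split=> // w; rewrite mem_cat => /orP[].
    by have [_] := U1sp u' cu Uu; apply.
  have [cu2 Uu2] := sp2 u' cu Uu; have [_] := U0sp u' cu2 Uu2; apply.
move=> a Aa; have := Apos a Aa; rewrite lexpos_cons => /andP[+ _].
rewrite le_eqVlt => /orP[/eqP au|au].
  by apply: (@incone_sub U0); [move=> w wU; rewrite mem_cat wU orbT|exact: U0A].
by apply: (@incone_sub U1); [move=> w wU; rewrite mem_cat wU|exact: U1A].
Qed.

End Cones.

(** * Scaling and division by powers of p *)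

Section WellOrderedImages.
Variables (G : lmodType rat) (le : rel G) (p : nat).
Hypothesis leG : group_order le.
Hypothesis leZ : forall q a, 0 <= q -> le 0 a -> le 0 (q *: a).
Hypothesis p_gt1 : (1 < p)%N.

Lemma goleZ2 q a b : 0 < q -> le (q *: a) (q *: b) = le a b.
Proof.
move=> q0; rewrite -(gole_sub0 leG) -[RHS](gole_sub0 leG) -scalerBr.
apply/idP/idP.
  move=> /(leZ (_ : 0 <= q^-1)); rewrite scalerA mulVf ?gt_eqF // scale1r.
  by apply; rewrite invr_ge0 ltW.
by apply: leZ; apply: ltW.
Qed.

Lemma wo_scale q (A : set G) : 0 < q -> wo le A -> wo le [set q *: a | a in A].
Proof.
move=> q0 woA B BA [b' Bb]; have [b Ab bE] := BA _ Bb.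
have [||m [Bm Am] mmin] := woA [set a | B (q *: a) /\ A a].
- by move=> a [].
- by exists b; rewrite /= bE.
exists (q *: m) => // c' Bc; have [c Ac cE] := BA _ Bc.
by rewrite -cE goleZ2 //; apply: mmin; rewrite /= cE.
Qed.

(** As for sums of two sets: below each s choose a / p^i with a least possible. A strictly smaller s
    does not lower a, and since a is negative a larger i would give a larger quotient, so i must
    drop. *)
Lemma wo_divs (A : set G) : wo le A -> (forall a, A a -> ~~ le 0 a) ->
  wo le (\bigcup_i [set (p ^ i)%:R^-1 *: a | a in A]).
Proof.
move=> woA A0 D DA [d Dd]; apply: contrapT => nmin.
pose dv i a : G := (p ^ i)%:R^-1 *: a.
have Dlt x : D x -> exists2 y, D y & ~~ le x y.
  move=> Dx; apply: contrapT => nlt; apply: nmin; exists x => // y Dy.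
  by apply: contrapT => /negP xy; apply: nlt; exists y.
have p0 i : 0 < (p ^ i)%:R^-1 :> rat.
  by rewrite invr_gt0 ltr0n expn_gt0 ltnW.
pose S s := [set a | A a /\ exists i, D (dv i a) /\ le (dv i a) s].
have Smin s : D s -> exists i a, [/\ A a, D (dv i a), le (dv i a) s &
    forall a', S s a' -> le a a'].
  move=> Ds; have [||a [Aa [i [Di ia]]] amin] := woA (S s).
  - by move=> a [].
  - have [i _ [a Aa aE]] := DA _ Ds; exists a; split=> //; exists i.
    by rewrite /dv aE gole_refl.
  by exists i, a.
suff main : forall i a, A a -> D (dv i a) ->
    (forall a', S (dv i a) a' -> le a a') -> False.
  have [i [a [Aa Dia ias amin]]] := Smin _ Dd.
  apply: (main i a Aa Dia) => a' [Aa' [i' [Di' h]]]; apply: amin.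
  by split=> //; exists i'; split=> //; apply: (go_trans leG h).
elim/ltn_ind => i IH a Aa Dia amin.
have [s Ds slt] := Dlt _ Dia.
have [i' [a' [Aa' Di' le' amin']]] := Smin _ Ds.
have aa' : le a a'.
  apply: amin; split=> //; exists i'; split=> //.
  exact: (go_trans leG le' (golt_le leG slt)).
apply: (IH i' _ a' Aa' Di') => [|a'' [Aa'' [i'' [Di'' h]]]]; last first.
  by apply: amin'; split=> //; exists i''; split=> //; apply: (go_trans leG h).
rewrite ltnNge; apply: contra slt => ii'.
apply: (go_trans leG _ le').
apply: (go_trans leG (y := dv i' a)); last by rewrite goleZ2.
rewrite -(goleN leG) -(gole_sub0 leG) opprK addrC -scalerBl.
rewrite -[_ *: a]opprK -scalerN -scaleNr; apply: leZ.
  rewrite oppr_ge0 subr_le0 lef_pV2 ?posrE ?ltr0n ?expn_gt0 ?(ltnW p_gt1) //.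
  by rewrite ler_nat leq_exp2l.
by rewrite -oppr0 goleN // golt_le // A0.
Qed.

End WellOrderedImages.

(** * The supports of the theorem form a Rayner family *)

Section ExponentFamily.
Variables (R : realType) (n : nat) (us : seq 'rV[R]_n) (p : nat).
Local Notation V := 'rV[rat]_n.
Local Notation leq_us := (lex_rat us).
Hypothesis us_anti : forall a b : V, leq_us a b -> leq_us b a -> a = b.
Hypothesis p_gt1 : (1 < p)%N.
Implicit Types (a b c w : V) (U : seq V) (A B : set V).

Definition lexposV U := forall w, w \in U -> lexpos us (ratv R w).

(* Membership in (1/k) G(p). *)
Definition inG k a := exists l (z : 'rV[int]_n), (k * p ^ l)%:R *: a = map_mx intr z.

(* The condition on supports, with a rational base point c and rational       *)
(* generators U of the cone, which need not contain the orthant.              *)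
Definition exp_family : set (set V) := [set A | exists k c U,
  [/\ (0 < k)%N, lexposV U, forall a, A a -> incone U (ratv R (a - c)),
      forall a, A a -> inG k a & wo leq_us A]].

Lemma lex_rat_order : group_order leq_us.
Proof.
split.
- by move=> a b /andP[ab ba]; apply: us_anti.
- by move=> a b c; apply: lex_le_trans.
- by move=> a b; apply: lex_le_total.
- by move=> c a b; rewrite /lex_rat !ratvD; apply: lex_leD.
Qed.
Local Notation leG := lex_rat_order.

Lemma lex_ratZ q a : 0 <= q -> leq_us 0 a -> leq_us 0 (q *: a).
Proof.
by move=> q0; rewrite /lex_rat ratv0 ratvZ => /lexposZ; apply; rewrite ler0q.
Qed.

Lemma lex_rat0 a : leq_us 0 a = lexpos us (ratv R a).
Proof. by rewrite /lex_rat ratv0. Qed.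

Lemma int_multiple a : exists2 d, (0 < d)%N & exists z : 'rV[int]_n,
  d%:R *: a = map_mx intr z.
Proof.
have [d d0 dz] : exists2 d : nat, (0 < d)%N & forall i : 'I_n, exists z : int,
    d%:R * a 0 i = z%:~R.
  exists (\prod_(i < n) `|denq (a 0%R i)|)%N.
    by rewrite prodn_gt0 // => i; rewrite absz_gt0 denq_neq0.
  move=> i; exists ((\prod_(j < n | j != i) `|denq (a 0%R j)|)%N%:Z * numq (a 0 i)).
  rewrite (bigD1 i) //= natrM mulrAC rmorphM /= mulrC; congr (_ * _).
  by rewrite numqE mulrC; congr (_ * _); rewrite -{2}(absz_denq (a 0 i)).
exists d => //; have /choice[z zE] := dz; exists (\row_i z i).
by apply/rowP => i; rewrite !mxE zE.
Qed.

Lemma inGD k k' a b : inG k a -> inG k' b -> inG (k * k') (a + b).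
Proof.
move=> [l [z zE]] [l' [z' zE']]; exists (l + l')%N.
exists ((k' * p ^ l')%:Z *: z + (k * p ^ l)%:Z *: z').
rewrite map_mxD !map_mxZ -zE -zE' scalerDr !scalerA expnD.
by congr (_ *: _ + _ *: _); rewrite !natrM; ring.
Qed.

(** Unlike in [inGD], the denominator k stays fixed, as sums of unbounded length require. *)
Lemma inGD1 k a b : inG k a -> inG k b -> inG k (a + b).
Proof.
move=> [l [z zE]] [l' [z' zE']]; exists (l + l')%N.
exists ((p ^ l')%:Z *: z + (p ^ l)%:Z *: z').
rewrite map_mxD !map_mxZ -zE -zE' scalerDr !scalerA expnD.
by congr (_ *: _ + _ *: _); rewrite !natrM; ring.
Qed.

Lemma inG0 k : inG k 0.
Proof. by exists 0%N, 0; rewrite scaler0 map_mx0. Qed.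

Lemma inG_mul k k' a : inG k a -> inG (k * k') a.
Proof. by rewrite -[a in X in _ -> X]addr0 => ka; apply: inGD => //; apply: inG0. Qed.

Lemma inG_div k i a : inG k a -> inG k ((p ^ i)%:R^-1 *: a).
Proof.
move=> [l [z zE]]; exists (l + i)%N, z.
rewrite scalerA expnD mulnA natrM mulfK // pnatr_eq0 expn_eq0 -leqn0 leqNgt.
by rewrite (ltnW p_gt1).
Qed.

Lemma lexposV_cat U U' : lexposV U -> lexposV U' -> lexposV (U ++ U').
Proof. by move=> h h' w; rewrite mem_cat => /orP[/h|/h']. Qed.

Lemma incone_catl U U' (v : 'rV[R]_n) : incone U v -> incone (U ++ U') v.
Proof. by apply: incone_sub => w wU; rewrite mem_cat wU. Qed.

Lemma incone_catr U U' (v : 'rV[R]_n) : incone U' v -> incone (U ++ U') v.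
Proof. by apply: incone_sub => w wU; rewrite mem_cat wU orbT. Qed.

(** The smaller base point serves for both sets once the difference of the base points is added to
    the generators. *)
Lemma exp_family_setU A B : exp_family A -> exp_family B -> exp_family (A `|` B).
Proof.
move=> [k [c [U [k0 Up Ac Ak woA]]]] [k' [c' [U' [k0' Up' Bc Bk woB]]]].
wlog cc : A B k c U k0 Up Ac Ak woA k' c' U' k0' Up' Bc Bk woB / leq_us c c'.
  move=> H; case/orP: (go_total leG c c') => h.
    exact: (H A B k c U k0 Up Ac Ak woA k' c' U').
  by rewrite setUC; apply: (H B A k' c' U' k0' Up' Bc Bk woB k c U).
exists (k * k')%N, c, (U ++ (c' - c) :: U'); split.
- by rewrite muln_gt0 k0.
- apply: lexposV_cat => // w; rewrite inE => /orP[/eqP->|/Up'//].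
  by rewrite ratvB lexpos_sub.
- move=> a [/Ac|/Bc] ac; first exact: incone_catl.
  have -> : a - c = (a - c') + (c' - c) by rewrite addrA subrK.
  apply: incone_catr; rewrite ratvD; apply: inconeD.
    by apply: incone_sub ac => w wU; rewrite inE wU orbT.
  by apply: incone_gen; rewrite mem_head.
- by move=> a [/Ak|/Bk] ak; [|rewrite mulnC]; apply: inG_mul.
- exact: (wo_setU leG).
Qed.

Lemma exp_family_rayner : rayner_family leq_us p exp_family.
Proof.
split.
- by move=> A [k [c [U []]]].
- move=> A B BA [k [c [U [k0 Up Ac Ak woA]]]]; exists k, c, U; split=> //.
  + by move=> a /BA/Ac.
  + by move=> a /BA/Ak.
  + exact: wo_sub woA.
- move=> a; have [d d0 [z zE]] := int_multiple a.
  exists d, a, [::]; split=> // [_ ->|_ ->|].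
  + by rewrite subrr ratv0; apply: incone0.
  + by exists 0%N, z; rewrite expn0 muln1.
  + exact: (wo_set1 leG).
- exact: exp_family_setU.
- move=> A B [k [c [U [k0 Up Ac Ak woA]]]] [k' [c' [U' [k0' Up' Bc Bk woB]]]].
  exists (k * k')%N, (c + c'), (U ++ U'); split.
  + by rewrite muln_gt0 k0.
  + exact: lexposV_cat.
  + move=> _ [a Aa [b Bb <-]]; rewrite opprD addrACA ratvD; apply: inconeD.
      exact/incone_catl/Ac.
    exact/incone_catr/Bc.
  + by move=> _ [a Aa [b Bb <-]]; apply: inGD; [exact: Ak|exact: Bk].
  + exact: (wo_addset leG).
- move=> A [k [c [U [k0 Up Ac Ak woA]]]] A0.
  have [|U' [Up' _ AU']] := positive_cone Up _ woA Ac.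
    by move=> a /A0; rewrite lex_rat0.
  exists k, 0, U'; split=> //.
  + move=> _ [s sA ->]; rewrite subr0 big_seq; elim/big_rec: _ => [|a b /sA/AU' aU bU].
      by rewrite ratv0; apply: incone0.
    by rewrite ratvD; apply: inconeD.
  + move=> _ [s sA ->]; rewrite big_seq.
    elim/big_rec: _ => [|a b /sA/Ak]; first exact: inG0.
    exact: inGD1.
  + exact: (wo_sums leG).
- move=> A [k [c [U [k0 Up Ac Ak woA]]]].
  have p0 : 0 < p%:R^-1 :> rat by rewrite invr_gt0 ltr0n ltnW.
  exists k, (p%:R^-1 *: c), U; split=> //.
  + move=> _ [a /Ac ac <-]; rewrite -scalerBr ratvZ; apply: inconeZ => //.
    by rewrite ler0q ltW.
  + by move=> _ [a /Ak ak <-]; have := inG_div 1 ak; rewrite expn1.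
  + exact: (wo_scale leG lex_ratZ).
move=> A [k [c [U [k0 Up Ac Ak woA]]]] A0.
have p_ge1 i : 1 <= (p ^ i)%:R :> rat by rewrite ler1n expn_gt0 ltnW.
have p0 i : 0 <= (p ^ i)%:R^-1 :> rat by rewrite invr_ge0 (le_trans ler01).
(* One base point for all the c / p^i: 0 if c >= 0, with c as a new generator, and c itself if c <=
   0, with - c as a new generator. *)
have [c' [U' [Up' UU' cc']]] : exists c' U', [/\ lexposV U', {subset U <= U'} &
    forall i, incone U' (ratv R ((p ^ i)%:R^-1 *: c - c'))].
  case/orP: (go_total leG 0 c) => c0.
    exists 0, (c :: U); split.
    - by move=> w; rewrite inE => /orP[/eqP->|/Up//]; rewrite -lex_rat0.
    - by move=> w wU; rewrite inE wU orbT.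
    move=> i; rewrite subr0 ratvZ; apply: inconeZ; first by rewrite ler0q.
    by apply: incone_gen; rewrite mem_head.
  exists c, (- c :: U); split.
  - move=> w; rewrite inE => /orP[/eqP->|/Up//].
    by rewrite -lex_rat0 -oppr0 (goleN leG).
  - by move=> w wU; rewrite inE wU orbT.
  move=> i; have -> : (p ^ i)%:R^-1 *: c - c = (1 - (p ^ i)%:R^-1) *: - c.
    by rewrite scalerN scalerBl scale1r opprB.
  rewrite ratvZ; apply: inconeZ; last by apply: incone_gen; rewrite mem_head.
  by rewrite ler0q subr_ge0 invf_le1 // (lt_le_trans ltr01).
exists k, c', U'; split=> //.
- move=> _ [i _ [a /Ac ac <-]].
  have -> : (p ^ i)%:R^-1 *: a - c' =
      (p ^ i)%:R^-1 *: (a - c) + ((p ^ i)%:R^-1 *: c - c').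
    by rewrite scalerBr addrA subrK.
  rewrite ratvD ratvZ; apply: inconeD => //; apply: inconeZ; first by rewrite ler0q.
  exact: incone_sub ac.
- by move=> _ [i _ [a /Ak ak <-]]; apply: inG_div.
- exact: (wo_divs leG lex_ratZ).
Qed.

End ExponentFamily.

(** * Equivalence with the support condition of the theorem *)

Section SupportCondition.
Variables (R : realType) (n : nat) (us : seq 'rV[R]_n) (p : nat).
Local Notation V := 'rV[rat]_n.
Hypothesis us_anti : forall a b : V, lex_rat us a b -> lex_rat us b a -> a = b.
Hypothesis us_pos : positive_set (lex_le us) (orthant R n).
Hypothesis p_gt1 : (1 < p)%N.
Implicit Types (a b c w : V) (U : seq V) (A B : set V).

(** [wo_chain] asks for a unique minimum. Uniqueness holds because the vectors concerned are
    rational, where the preorder is antisymmetric. *)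
Lemma well_ordered_setE A :
  well_ordered_set (lex_le us) [set ratv R a | a in A] <-> wo (lex_rat us) A.
Proof.
split=> [woA B BA [b Bb]|woA C CA [v Cv]].
  have [|| z [[zB zmin] _]] := woA (mem [set ratv R a | a in B]).
  - move=> v; rewrite !inE => -[a Ba <-]; exists a => //; exact: BA.
  - by exists (ratv R b); rewrite !inE; exists b.
  move: zB; rewrite !inE => -[a Ba aE]; exists a => // d Bd.
  rewrite /lex_rat aE; apply: zmin; rewrite !inE; exists d => //.
have CA' u : u \in C -> exists2 a, A a & ratv R a = u.
  by move=> /CA; rewrite !inE => -[a Aa <-]; exists a.
have [a Aa aE] := CA' v Cv.
have [||b [Ab Cb] bmin] := woA [set b | A b /\ ratv R b \in C].
- by move=> b [].
- by exists a; split=> //; rewrite aE.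
have bmin' u : u \in C -> lex_le us (ratv R b) u.
  by move=> uC; have [d Ad dE] := CA' u uC; rewrite -dE; apply: bmin; rewrite /= dE.
exists (ratv R b); split=> [|z [zC zmin]]; first by split.
have [d Ad dE] := CA' z zC; rewrite -dE; congr ratv; apply: us_anti.
  by apply: bmin; rewrite /= dE.
by rewrite /lex_rat dE; apply: zmin.
Qed.

Definition units : seq V := [seq delta_mx 0 i | i <- enum 'I_n].

Lemma ratv_delta i : ratv R (delta_mx 0 i : V) = delta_mx 0 i.
Proof. exact: map_delta_mx. Qed.

Lemma units_pos : lexposV us units.
Proof.
move=> _ /mapP[i _ ->]; rewrite ratv_delta; apply: us_pos => j.
by rewrite mxE ler0n.
Qed.

Lemma orthant_units v : orthant R n v -> incone units v.
Proof.
move=> v0; rewrite [v]row_sum_delta; apply: incone_sum => i _; apply: inconeZ => //.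
by rewrite -ratv_delta; apply: incone_gen; apply: map_f; rewrite mem_enum.
Qed.

Lemma ratv_int (z : 'rV[int]_n) : ratv R (map_mx intr z) = intv R z.
Proof. by apply/rowP => i; rewrite !mxE ratr_int. Qed.

(** Clearing the denominators of each generator does not change the cone. *)
Lemma incone_rational U : exists2 sigma, rational_cone sigma &
  forall v : 'rV[R]_n, sigma v <-> incone U v.
Proof.
have /choice[dz dzP] : forall w, exists dz : nat * 'rV[int]_n,
    (0 < dz.1)%N /\ dz.1%:R *: w = map_mx intr dz.2.
  by move=> w; have [d d0 [z zE]] := int_multiple w; exists (d, z).
have dE w : intv R (dz w).2 = (dz w).1%:R *: ratv R w.
  by case: (dzP w) => _ zE; rewrite -ratv_int -zE ratvZ ratr_nat.
pose u (i : 'I_(size U)) := (dz (nth 0 U i)).2.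
eexists; first by exists (size U), u.
move=> v; split=> [[l l0 ->]|[l l0 ->]].
  apply: incone_sum => i _; apply: inconeZ => //; rewrite /u dE.
  by apply: inconeZ => //; apply: incone_gen; rewrite mem_nth.
exists (fun i => l (nth 0 U i) / (dz (nth 0 U i)).1%:R).
  by move=> i; rewrite divr_ge0.
rewrite (big_nth 0) big_mkord; apply: eq_bigr => i _; rewrite /u dE scalerA divfK //.
by rewrite pnatr_eq0 -lt0n; case: (dzP (nth 0 U i)).
Qed.

Lemma exp_familyE A : exp_family us p A <->
  exists (k : nat) (c : 'rV[int]_n) (sigma : set 'rV[R]_n),
    [/\ (0 < k)%N,
        [/\ rational_cone sigma, positive_set (lex_le us) sigma &
            orthant R n `<=` sigma],
        [set ratv R a | a in A] `<=` [set intv R c + v | v in sigma]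
                     `&` [set k%:R^-1 *: g | g in Gp R n p] &
        well_ordered_set (lex_le us) [set ratv R a | a in A]].
Proof.
split=> [[k [c [U [k0 Up Ac Ak woA]]]]|
  [k [c [sigma [k0 [[s [u sE]] spos _] Asub woA]]]]].
  have [sigma rs sP] := incone_rational (U ++ units).
  (* The base point is rounded down to an integer vector; the unit vectors among the generators
     absorb the fractional part and make the cone contain the orthant. *)
  exists k, (\row_i Num.floor (c 0 i)), sigma; split=> //; last exact/well_ordered_setE.
    split=> // [v /sP|v v0]; last exact/sP/incone_catr/orthant_units.
    exact/incone_lexpos/lexposV_cat/units_pos.
  move=> _ [a Aa <-]; split.
    exists (ratv R a - intv R (\row_i Num.floor (c 0 i))); last by rewrite addrC subrK.
    apply/sP; rewrite -ratv_int -ratvB.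
    have -> : a - map_mx intr (\row_i Num.floor (c 0 i)) =
       (a - c) + (c - map_mx intr (\row_i Num.floor (c 0 i))) by rewrite addrA subrK.
    rewrite ratvD; apply: inconeD; first exact/incone_catl/Ac.
    apply: incone_catr; apply: orthant_units => i.
    by rewrite !mxE ler0q subr_ge0 floor_le.
  have [l [z zE]] := Ak a Aa.
  exists ((p ^ l)%:R^-1 *: intv R z); first by exists l => //; exists z.
  rewrite -ratv_int -zE ratvZ ratr_nat !scalerA natrM.
  have pl0 : (p ^ l)%:R != 0 :> R by rewrite pnatr_eq0 -lt0n expn_gt0 ltnW.
  have kn0 : k%:R != 0 :> R by rewrite pnatr_eq0 -lt0n.
  by rewrite [_ * (_ * _)](_ : _ = 1) ?scale1r //; field; rewrite pl0 kn0.
pose U := [seq map_mx intr (u i) : V | i <- enum 'I_s].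
exists k, (map_mx intr c), U; split=> //; last exact/well_ordered_setE.
- move=> _ /mapP[i _ ->]; rewrite ratv_int; apply: spos; rewrite sE.
  exists (fun j => (j == i)%:R) => [j|]; first by rewrite ler0n.
  rewrite (bigD1 i) //= eqxx scale1r big1 ?addr0 // => j /negbTE ->.
  by rewrite scale0r.
- move=> a Aa; have [|[v sv vE] _] := Asub (ratv R a); first by exists a.
  rewrite ratvB ratv_int -vE addrC addKr; move: sv; rewrite sE => -[l l0 ->].
  apply: incone_sum => i _; apply: inconeZ => //; rewrite -ratv_int.
  by apply: incone_gen; apply: map_f; rewrite mem_enum.
move=> a Aa; have [|_ [_ [l _ [z _ <-]] aE]] := Asub (ratv R a); first by exists a.
exists l, z; apply: (@ratv_inj R); rewrite ratvZ ratr_nat ratv_int -aE !scalerA natrM.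
have pl0 : (p ^ l)%:R != 0 :> R by rewrite pnatr_eq0 -lt0n expn_gt0 ltnW.
have kn0 : k%:R != 0 :> R by rewrite pnatr_eq0 -lt0n.
by rewrite (_ : _ * _ = 1) ?scale1r //; field; rewrite pl0 kn0.
Qed.

End SupportCondition.

(** * Power series and their fractions *)

Section FractionLift.
Variables (A : idomainType) (F : fieldType) (iota : {rmorphism A -> F}).
Hypothesis iota_inj : injective iota.
Local Notation tofrac := (@FracField.tofrac A).

Lemma fracP (x : {fraction A}) : exists nd : A * A,
  nd.2 != 0 /\ x = tofrac nd.1 / tofrac nd.2.
Proof.
elim/quotW: x => r; exists (frac r); split; first exact: denom_ratioP.
have d0 := denom_ratioP r.
unlock FracField.tofrac.
rewrite -[X in _ = _ * X]FracField.pi_inv -[RHS]FracField.pi_mul.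
rewrite /FracField.mulf /FracField.invf !numden_Ratio ?oner_neq0 //.
by rewrite mulr1 mul1r Ratio_numden.
Qed.

(** The image of a fraction is computed from a chosen numerator and denominator; [jE] shows by
    cross-multiplication that every other representation gives the same value. *)
Lemma fraction_lift : exists j : {rmorphism {fraction A} -> F},
  forall a, j (tofrac a) = iota a.
Proof.
have /choice[nd ndP] := fracP.
pose j x := iota (nd x).1 / iota (nd x).2.
have iota0 a : a != 0 -> iota a != 0.
  by rewrite -(inj_eq iota_inj) rmorph0.
have jE a b : b != 0 -> j (tofrac a / tofrac b) = iota a / iota b.
  move=> b0; have [d0 /eqP] := ndP (tofrac a / tofrac b); rewrite /j.
  case: (nd _) d0 => a' b' /= b0'.
  rewrite eqr_div ?tofrac_eq0 // -!tofracM tofrac_eq => /eqP ab.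
  by apply/eqP; rewrite eqr_div ?iota0 // -!rmorphM ab.
have j1 a : j (tofrac a) = iota a.
  by rewrite -[tofrac a]divr1 -tofrac1 jE ?oner_neq0 // rmorph1 divr1.
have jD : zmod_morphism j.
  move=> x y; have [b0 ->] := ndP x; have [d0 ->] := ndP y.
  case: (nd x) (nd y) b0 d0 => a b [c d] /= b0 d0.
  rewrite -mulNr addf_div ?tofrac_eq0 // mulNr -!tofracM -tofracB jE ?mulf_neq0 //.
  rewrite !jE ?mulf_neq0 // -[X in _ = _ + X]mulNr addf_div ?iota0 //.
  by rewrite rmorphB !rmorphM mulNr.
have jM : monoid_morphism j.
  split=> [|x y]; first by rewrite -tofrac1 j1 rmorph1.
  have [b0 ->] := ndP x; have [d0 ->] := ndP y.
  case: (nd x) (nd y) b0 d0 => a b [c d] /= b0 d0.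
  rewrite mulf_div -!tofracM !jE ?mulf_neq0 // mulf_div.
  by rewrite !rmorphM.
pose jz := GRing.isZmodMorphism.Build _ _ j jD.
pose jm := GRing.isMonoidMorphism.Build _ _ j jM.
pose jj : {rmorphism {fraction A} -> F} := HB.pack j jz jm.
by exists jj.
Qed.

End FractionLift.

(** * Power series as series with rational exponents *)

Section PowerSeriesEmbedding.
Variables (n : nat) (K : fieldType).
Local Notation V := 'rV[rat]_n.
Implicit Types (f g : mfps n K) (m : 'X_{1..n}) (a b : V).

Definition mvec m : V := \row_i (m i)%:R.

Lemma mvec_inj : injective mvec.
Proof.
move=> m m' /rowP mm'; apply/mnmP => i; have := mm' i; rewrite !mxE.
by move=> /eqP; rewrite eqr_nat => /eqP.
Qed.

Lemma mvecD m m' : mvec (m + m')%MM = mvec m + mvec m'.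
Proof. by apply/rowP => i; rewrite !mxE mnmDE natrD. Qed.

Lemma qs_of_mfps_mvec f m : qs_of_mfps f (mvec m) = f m.
Proof.
rewrite /qs_of_mfps; have -> : [forall i, mvec m 0 i \is a Num.nat].
  by apply/forallP => i; rewrite mxE natr_nat.
by congr (f _); apply/mnmP => i; rewrite mnmE mxE natrK.
Qed.

Lemma sup_qs_of_mfps f a : spt (qs_of_mfps f) a -> exists m, a = mvec m.
Proof.
rewrite /spt /qs_of_mfps /=; case: forallP => [anat _|]; last by rewrite eqxx.
exists [multinom Num.truncn (a 0%R i) | i < n]; apply/rowP => i.
by rewrite mxE mnmE truncnK.
Qed.

Lemma mvec_ext (x y : V -> K) :
  (forall a, spt x a -> exists m, a = mvec m) ->
  (forall a, spt y a -> exists m, a = mvec m) ->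
  (forall m, x (mvec m) = y (mvec m)) -> x = y.
Proof.
move=> xm ym xy; apply/funext => a.
case: (pselect (exists m, a = mvec m)) => [[m ->]//|na].
transitivity (0 : K); first by apply/eqP/negPn/negP => /xm.
by apply/esym/eqP/negPn/negP => /ym.
Qed.

(** Sending a pair (k1, k2) with k1 + k2 = m to [mvec k1] is injective and reaches every exponent
    that contributes to the convolution at [mvec m]. *)
Lemma qs_of_mfpsM f g : qs_of_mfps (f * g) = conv (qs_of_mfps f) (qs_of_mfps g).
Proof.
apply: mvec_ext.
- exact: sup_qs_of_mfps.
- move=> a /sup_conv[b /sup_qs_of_mfps[m ->] [c /sup_qs_of_mfps[m' ->] <-]].
  by exists (m + m')%MM; rewrite mvecD.
move=> m; rewrite qs_of_mfps_mvec /conv; set d := (mdeg m).+1.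
pose P := fun k : 'X_{1..n < d, d} => m == (k.1 + k.2)%MM.
have PE (k : 'X_{1..n < d, d}) : P k -> mvec m - mvec k.1 = mvec k.2.
  by move=> /eqP ->; rewrite mvecD addrC addKr.
rewrite (fsbigE [seq mvec (bmnm k.1) | k : 'X_{1..n < d, d} <- index_enum _ & P k]) //.
- rewrite -[LHS]/(mfps_mul f g m) /mfps_mul big_map big_filter_cond.
  apply: eq_big => [k|k Pk]; first by rewrite in_setT andbT.
  by rewrite PE // !qs_of_mfps_mvec.
- rewrite map_inj_in_uniq ?filter_uniq ?index_enum_uniq // => k k'.
  rewrite !mem_filter => /andP[Pk _] /andP[Pk' _] kk.
  have k1 := mvec_inj kk; have := PE _ Pk'; rewrite -kk PE // => /mvec_inj k2.
  case: k k' k1 k2 {Pk Pk' kk} => [[k1 h1] [k2 h2]] [[k1' h1'] [k2' h2']] /= e1 e2.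
  by congr pair; apply: val_inj.
move=> a _ na; apply/eqP/negPn/negP; rewrite mulf_eq0 negb_or => /andP[].
move=> /sup_qs_of_mfps[m1 aE] /sup_qs_of_mfps[m2]; rewrite aE => /eqP.
rewrite subr_eq addrC -mvecD => /eqP/mvec_inj mE.
have h1 : (mdeg m1 < d)%N by rewrite /d mE mdegD ltnS leq_addr.
have h2 : (mdeg m2 < d)%N by rewrite /d mE mdegD ltnS leq_addl.
move/negP: na; apply; apply/mapP; exists (BMultinom h1, BMultinom h2) => //.
by rewrite mem_filter mem_index_enum andbT; apply/eqP.
Qed.

Lemma qs_of_mfps1 : qs_of_mfps (1 : mfps n K) = one_at0 K.
Proof.
have mvec0 : mvec 0%MM = 0 by apply/rowP => i; rewrite !mxE mnm0E.
apply: mvec_ext.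
- exact: sup_qs_of_mfps.
- move=> a; rewrite /spt /one_at0 /=; case: (eqVneq a 0) => [->|]; last by rewrite eqxx.
  by exists 0%MM.
move=> m; rewrite qs_of_mfps_mvec /one_at0 -mvec0 (inj_eq mvec_inj) //.
Qed.

Lemma qs_of_mfpsB f g a : qs_of_mfps (f - g) a = qs_of_mfps f a - qs_of_mfps g a.
Proof. by rewrite /qs_of_mfps; case: ifP => // _; rewrite subrr. Qed.

Lemma qs_of_mfps_inj : injective (@qs_of_mfps n K).
Proof.
by move=> f g fg; apply/funext => m; rewrite -!qs_of_mfps_mvec fg.
Qed.

End PowerSeriesEmbedding.

Lemma mvec_sums n (m : 'X_{1..n}) : sums [set` units n] (mvec m).
Proof.
have -> : mvec m = \sum_i (delta_mx 0 i : 'rV[rat]_n) *+ m i.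
  rewrite [mvec m]row_sum_delta; apply: eq_bigr => i _.
  by rewrite mxE scaler_nat.
elim/big_rec: _ => [|i v _ vs]; first exact: sums0.
apply: sumsD => //; elim: (m i) => [|k IH]; first exact: sums0.
rewrite mulrS; apply: sumsD => //; apply: sub_sums => /=.
by apply: map_f; rewrite mem_enum.
Qed.

Theorem theorem6p3 (R : realType) (n : nat) (le : rel 'rV[R]_n)
    (K : closedFieldType) (p : nat) :
  (0 < n)%N -> Ord le -> p \in [pchar K] ->
  exists (F : closedFieldType) (phi : F -> qseries n K),
    [/\ injective phi /\ range phi = Sset p le K,
        phi 1 = qs_one n K,
        {morph phi : a b / a + b},
        {morph phi : a b / a * b >-> qs_mul a b} &
        exists j : {rmorphism {fraction (mfps n K)} -> F},
          forall f : mfps n K, phi (j (FracField.tofrac f)) = qs_of_mfps f].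
Proof.
move=> _ [[[us ->] us_anti] us_pos] pK.
have p_gt1 : (1 < p)%N by exact: prime_gt1 (pcharf_prime pK).
have famP := exp_family_rayner us_anti p_gt1.
have [F [phi [phi_inj phi_range phi1 phiD phiM]]] :=
  rayner_closed_field (lex_rat_order us_anti) famP pK.
(* The exponents of f lie in the monoid generated by the unit vectors. These are nonnegative for the
   order, so [rf_sums] applies. *)
have range_qs f : exists x : F, phi x = qs_of_mfps f.
  have : [set x : qseries n K | exp_family us p (spt x)] (qs_of_mfps f).
    apply: (rf_sub famP (A := sums [set` units n])).
      by move=> a /sup_qs_of_mfps[m ->]; apply: mvec_sums.
    apply: (rf_sums famP) => [|a /= /(units_pos us_pos)]; last by rewrite -lex_rat0.
    elim: (units n) => [|w s IH].
      by apply: (rf_sub famP _ (rf_set1 famP 0)) => a.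
    apply: (rf_sub famP _ (rf_setU famP (rf_set1 famP w) IH)) => a /=.
    by rewrite inE => /orP[/eqP ->|]; [left|right].
  by rewrite -phi_range => -[x _]; exists x.
have /choice[io ioE] := range_qs.
have phiB x y : phi (x - y) = fun g => phi x g - phi y g.
  have E := phiD (x - y) y; rewrite subrK in E.
  by rewrite E; apply/funext => g; rewrite addrK.
have ioB : zmod_morphism io.
  move=> f g; apply: phi_inj; rewrite phiB !ioE; apply/funext => a.
  exact: qs_of_mfpsB.
have ioM : monoid_morphism io.
  split=> [|f g]; apply: phi_inj; first by rewrite ioE qs_of_mfps1 phi1.
  by rewrite phiM !ioE qs_of_mfpsM.
pose ioz := GRing.isZmodMorphism.Build _ _ io ioB.
pose iom := GRing.isMonoidMorphism.Build _ _ io ioM.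
pose iota : {rmorphism mfps n K -> F} := HB.pack io ioz iom.
have [f g fg|j jE] := @fraction_lift _ _ iota.
  by apply: qs_of_mfps_inj; rewrite -!ioE; congr phi.
exists F, phi; split.
- split=> //; rewrite phi_range; apply/seteqP; split=> x /=.
    by move/(exp_familyE us_anti us_pos p_gt1).
  by move=> h; apply/(exp_familyE us_anti us_pos p_gt1).
- by rewrite phi1.
- by move=> x y; rewrite phiD.
- by move=> x y; rewrite phiM.
by exists j => f; rewrite jE ioE.
Qed.
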